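(* Let $\Omega\subset\mathbb{R}^N$ ($N\geq 1$) be an open and bounded $BV$ extension domain, and let $p\in[1,\infty]$. Let $(u_n)_{n\ge1}\subset\mathcal{R}_p(\Omega)$ be a sequence which is bounded in $L^1(\Omega)$, i.e. $\sup_n\|u_n\|_{1}<\infty$, and which has uniformly bounded $(\varepsilon,p)$-variations, i.e. $\sup_n\,(\varepsilon,p)\text{-}\mathrm{Var}\,u_n<\infty$ for every $\varepsilon>0$. Then there is a subsequence $(u_{n(k)})_k$ of $(u_n)_n$ and a function $u\in L^1(\Omega)$ such that $u_{n(k)}\to u$ in $L^1(\Omega)$ as $k\to\infty$.
   Context: Functions are real-valued and, as usual, elements of $L^p(\Omega)$ are identified when they agree Lebesgue-almost everywhere; $\|\cdot\|_p$ denotes the $L^p(\Omega)$-norm with respect to Lebesgue measure. When $N=1$, $\Omega$ is assumed to be an interval. Variation: for $u\in L^1(\Omega)$, $\mathrm{Var}\,u:=\sup\{\int_\Omega u\,\mathrm{div}\,\varphi\,dx \mid \varphi\in[C_c^1(\Omega)]^N,\ \|\varphi\|_\infty\le 1\}\in[0,\infty]$, and $BV(\Omega):=\{u\in L^1(\Omega)\mid \mathrm{Var}\,u<\infty\}$, a Banach space with norm $\|u\|_{BV}=\|u\|_1+\mathrm{Var}\,u$. $BV$ extension domain (Ambrosio–Fusco–Pallara, Definition 3.20): an open set $\Omega\subset\mathbb{R}^N$ with bounded boundary such that for every open set $A\supset\overline{\Omega}$ and every $m\ge1$ there is a linear continuous extension operator $T:[BV(\Omega)]^m\to[BV(\mathbb{R}^N)]^m$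 (so $Tu=u$ a.e. in $\Omega$) with: $Tu=0$ a.e. in $\mathbb{R}^N\setminus A$ for all $u\in[BV(\Omega)]^m$; $|D(Tu)|(\partial\Omega)=0$ for all $u\in[BV(\Omega)]^m$; and for every $q\in[1,\infty]$ the restriction of $T$ to $[W^{1,q}(\Omega)]^m$ is a linear continuous map into $[W^{1,q}(\mathbb{R}^N)]^m$. $(\varepsilon,p)$-variation: for $u\in L^1(\Omega)$, $p\in[1,\infty]$, $\varepsilon>0$, $(\varepsilon,p)\text{-}\mathrm{Var}\,u:=\inf\{\mathrm{Var}\,v\mid v\in BV(\Omega),\ \|u-v\|_p\le\varepsilon\}$, with the convention that the infimum over the empty set is $\infty$. $p$-regulated functions: $\mathcal{R}_p(\Omega):=\{u\in L^1(\Omega)\mid (\varepsilon,p)\text{-}\mathrm{Var}\,u<\infty\text{ for every }\varepsilon>0\}$. *)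

(* Defs.v *)
From HB Require Import structures.
From mathcomp Require Import all_boot all_order all_algebra.
From mathcomp Require Import all_classical all_reals all_analysis.

Set Implicit Arguments.
Unset Strict Implicit.
Unset Printing Implicit Defensive.

Import Order.TTheory GRing.Theory Num.Theory.
Import numFieldNormedType.Exports.

Local Open Scope classical_set_scope.
Local Open Scope ring_scope.

(* 'rV[R]_n carries the sigma-algebra generated by the coordinates, which is
   the Borel one (compare the library's instance on n.-tuple T). *)
Definition measure_rV_display : measure_display.
Proof. by constructor. Qed.

Section measurable_rV.
Context {R : realType} (n : nat).

Let coors : 'I_n -> 'rV[R]_n -> R := fun i x => x ord0 i.

Let rV_set0 : g_sigma_preimage coors set0.
Proof. exact: sigma_algebra0. Qed.

Let rV_setC A : g_sigma_preimage coors A -> g_sigma_preimage coors (~` A).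
Proof. exact: sigma_algebraC. Qed.

Let rV_bigcup (F : (set 'rV[R]_n)^nat) :
  (forall i, g_sigma_preimage coors (F i)) ->
  g_sigma_preimage coors (\bigcup_i (F i)).
Proof. exact: sigma_algebra_bigcup. Qed.

HB.instance Definition _ := @isMeasurable.Build measure_rV_display
  'rV[R]_n (g_sigma_preimage coors) rV_set0 rV_setC rV_bigcup.

End measurable_rV.

Lemma measurable_coord (R : realType) n (i : 'I_n) :
  measurable_fun [set: 'rV[R]_n] (fun x : 'rV[R]_n => x ord0 i).
Proof.
move=> _ Y mY; rewrite setTI; apply: sub_sigma_algebra => /=.
rewrite -bigcup_seq/=; exists i => /=; first by rewrite mem_index_enum.
by exists Y => //; rewrite setTI.
Qed.

Lemma measurable_fun_rVP (R : realType) d (T : measurableType d) n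
    (f : T -> 'rV[R]_n) :
  measurable_fun [set: T] f <->
  forall i, measurable_fun [set: T] (fun x => f x ord0 i).
Proof.
split=> [mf i|mf].
  exact: (measurableT_comp (@measurable_coord R n i) mf).
apply: (measurability
  (\big[setU/set0]_(i < n) preimage_set_system [set: 'rV[R]_n]
     (fun x : 'rV[R]_n => x ord0 i) measurable)) => //.
move=> _ [A + <-]; rewrite -bigcup_seq/= => -[i _ [Y mY <-]].
by rewrite setTI -comp_preimage; exact: mf.
Qed.

Section lebesgue_rV.
Context {R : realType}.

Definition cons_rV n (y : R * 'rV[R]_n) : 'rV[R]_n.+1 :=
  \row_i (if unlift ord0 i is Some j then y.2 ord0 j else y.1).

Lemma cons_rV0 n (y : R * 'rV[R]_n) : cons_rV y ord0 ord0 = y.1.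
Proof. by rewrite mxE unlift_none. Qed.

Lemma cons_rVS n (y : R * 'rV[R]_n) i :
  cons_rV y ord0 (lift ord0 i) = y.2 ord0 i.
Proof. by rewrite mxE liftK. Qed.

Lemma measurable_cons_rV n :
  measurable_fun [set: measurableTypeR R * 'rV[R]_n] (@cons_rV n).
Proof.
apply/measurable_fun_rVP => i.
case: (unliftP ord0 i) => [j ->|->].
  under eq_fun do rewrite cons_rVS.
  exact: (measurableT_comp (@measurable_coord R n j)).
by under eq_fun do rewrite cons_rV0; exact: measurable_fst.
Qed.

Definition uncons_rV n (x : 'rV[R]_n.+1) : R * 'rV[R]_n :=
  (x ord0 ord0, \row_i x ord0 (lift ord0 i)).

Lemma measurable_uncons_rV n : measurable_fun [set: 'rV[R]_n.+1]
  (@uncons_rV n : _ -> measurableTypeR R * 'rV[R]_n).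
Proof.
apply: measurable_fun_pair => /=; first exact: measurable_coord.
apply/measurable_fun_rVP => i; under eq_fun do rewrite mxE.
exact: measurable_coord.
Qed.

Lemma cons_rVK n : cancel (@cons_rV n) (@uncons_rV n).
Proof.
move=> [a v]; rewrite /uncons_rV cons_rV0; congr pair.
by apply/rowP => i; rewrite mxE cons_rVS.
Qed.

Lemma uncons_rVK n : cancel (@uncons_rV n) (@cons_rV n).
Proof.
move=> x; apply/rowP => i.
by case: (unliftP ord0 i) => [j ->|->]; rewrite ?cons_rV0 ?cons_rVS ?mxE.
Qed.

Section step.
Variables (n : nat) (m : {sigma_finite_measure set 'rV[R]_n -> \bar R}).

Let mprod :=
  (@lebesgue_measure R \x m)%E : {measure set _ -> \bar R}.

Definition lebesgue_step : set 'rV[R]_n.+1 -> \bar R :=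
  pushforward mprod (@cons_rV n).

Let preimage_measurable A : measurable A -> measurable (@cons_rV n @^-1` A).
Proof.
by move=> mA; rewrite -[X in measurable X]setTI; exact: measurable_cons_rV.
Qed.

Let lebesgue_step0 : lebesgue_step set0 = 0%E.
Proof. by rewrite /lebesgue_step /pushforward preimage_set0 measure0. Qed.

Let lebesgue_step_ge0 A : (0 <= lebesgue_step A)%E.
Proof. by rewrite /lebesgue_step /pushforward; exact: measure_ge0. Qed.

Let lebesgue_step_additive : semi_sigma_additive lebesgue_step.
Proof.
move=> F mF tF mUF; rewrite /lebesgue_step /pushforward preimage_bigcup.
apply: measure_semi_sigma_additive.
- by move=> k; exact: preimage_measurable.
- by apply/trivIsetP => i j _ _ ij; rewrite -preimage_setI;
    move/trivIsetP : tF => /(_ _ _ _ _ ij) ->//; rewrite preimage_set0.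
- by rewrite -preimage_bigcup; exact: preimage_measurable.
Qed.

HB.instance Definition _ := isMeasure.Build _ _ _ lebesgue_step
  lebesgue_step0 lebesgue_step_ge0 lebesgue_step_additive.

Let lebesgue_step_sigma_finite : sigma_finite setT lebesgue_step.
Proof.
have /sigma_finiteP[F [FT ndF Foo]] := sigma_finiteT (@lebesgue_measure R).
have /sigma_finiteP[G [GT ndG Goo]] := sigma_finiteT m.
exists (fun k => @uncons_rV n @^-1` (F k `*` G k)).
  rewrite -preimage_bigcup; apply/esym/seteqP; split => // x _ /=.
  have : setT (x ord0 ord0) by [].
  rewrite FT => -[i _ Fi]; have : setT (uncons_rV x).2 by [].
  rewrite GT => -[j _ Gj]; exists (maxn i j) => //; split.
    by move: Fi; exact/subsetPset/ndF/leq_maxl.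
  by move: Gj; exact/subsetPset/ndG/leq_maxr.
move=> k; have [mF Fk] := Foo k; have [mG Gk] := Goo k; split.
  rewrite -[X in measurable X]setTI; apply: measurable_uncons_rV => //.
  exact: measurableX.
rewrite /lebesgue_step /pushforward -comp_preimage.
rewrite (_ : _ \o _ = id); last by apply/funext => y; exact: cons_rVK.
by rewrite preimage_id /mprod/= product_measure1E// lte_mul_pinfty// ge0_fin_numE.
Qed.

HB.instance Definition _ := @Measure_isSigmaFinite.Build _ _ _ lebesgue_step
  lebesgue_step_sigma_finite.

End step.

Fixpoint lebesgue n : {sigma_finite_measure set 'rV[R]_n -> \bar R} :=
  if n is n'.+1 then lebesgue_step (lebesgue n') else \d_(0 : 'rV[R]_0).

Lemma lebesgue_box n (a b : 'I_n -> R) : (forall i, a i <= b i) ->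
  lebesgue n [set x | forall i, x ord0 i \in `[a i, b i]] =
  (\prod_(i < n) (b i - a i))%:E.
Proof.
elim: n a b => [a b _|n IH a b ab].
  by rewrite big_ord0/= diracE mem_set//= => -[].
rewrite /= /lebesgue_step /pushforward/=.
rewrite (_ : _ @^-1` _ = `[a ord0, b ord0]%classic `*`
   [set x : 'rV_n | forall i, x ord0 i \in
     `[a (lift ord0 i), b (lift ord0 i)]]); last first.
  apply/seteqP; split=> [y yP|y [y1 y2] i] /=.
    by split=> [|i]; [rewrite -cons_rV0|rewrite -cons_rVS]; exact: yP.
  case: (unliftP ord0 i) => [j ->|->]; first by rewrite cons_rVS; exact: y2.
  by rewrite cons_rV0.
rewrite [LHS]product_measure1E//.
  rewrite [X in (_ * X)%E = _]IH => [|i]; last exact: ab.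
  rewrite big_ord_recl EFinM; congr (_ * _)%E.
  rewrite [LHS]lebesgue_measure_itv /= lte_fin.
  have := ab ord0; rewrite le_eqVlt => /orP[/eqP <-|->]; last by [].
  by rewrite ltxx subrr.
rewrite (_ : [set _ | _] = \bigcap_(i : 'I_n) ((fun x : 'rV[R]_n => x ord0 i)
  @^-1` `[a (lift ord0 i), b (lift ord0 i)]%classic)).
  apply: fin_bigcap_measurable => // i _; rewrite -[X in measurable X]setTI.
  exact: measurable_coord.
by apply/seteqP; split=> x /= xP i => [_|]; apply: xP.
Qed.

End lebesgue_rV.

(* Functions on an open set U are represented by total functions on 'rV[R]_N
   whose values outside U are irrelevant, and elements of L^p(U) by
   Borel representatives. *)
Section bounded_variation.
Context {R : realType} {N : nat}.
Local Notation E := 'rV[R]_N.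
Implicit Types (U : set E) (p q : \bar R) (u v w f : E -> R).

Definition LpNorm U p u : \bar R :=
  'N[lebesgue N]_p[(EFin \o u) \_ U]%E.

Definition Lp U p u : Prop :=
  measurable_fun U u /\ (LpNorm U p u < +oo)%E.

Definition partial (i : 'I_N) f : E -> R := fun x => 'D_(delta_mx ord0 i) f x.

Fixpoint Ck (k : nat) f : Prop :=
  if k is k'.+1 then
    (forall x, differentiable f x) /\ (forall i, Ck k' (partial i f))
  else continuous f.

Definition supp f : set E := closure [set x | f x != 0].

(* Elements of C_c^k(U) are extended by 0 outside U. *)
Definition Cck U (k : nat) f : Prop :=
  [/\ Ck k f, compact (supp f) & supp f `<=` U].

Definition Ccoo U f : Prop := forall k, Cck U k f.

Definition divergence (phi : 'I_N -> E -> R) (x : E) : R :=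
  \sum_i partial i (phi i) x.

(* The norm below 1 is the Euclidean one, not the sup norm of 'rV[R]_N. *)
Definition test_field U (phi : 'I_N -> E -> R) : Prop :=
  (forall i, Cck U 1 (phi i)) /\
  (forall x, Num.sqrt (\sum_i phi i x ^+ 2) <= 1).

Definition Var U u : \bar R :=
  ereal_sup [set (\int[lebesgue N]_(x in U) (u x * divergence phi x)%:E)%E
            | phi in test_field U].

Definition BV U u : Prop := Lp U 1 u /\ (Var U u < +oo)%E.

Definition BVnorm U u : \bar R := (LpNorm U 1 u + Var U u)%E.

Definition eps_Var U p (e : R) u : \bar R :=
  ereal_inf [set Var U v | v in [set v | BV U v /\
                                         (LpNorm U p (u \- v)%R <= e%:E)%E]].

Definition regulated U p u : Prop :=
  Lp U 1 u /\ forall e : R, 0 < e -> (eps_Var U p e u < +oo)%E.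

Definition weak_partial U (i : 'I_N) u g : Prop :=
  forall psi, Ccoo U psi ->
    (\int[lebesgue N]_(x in U) (u x * partial i psi x)%:E =
     - \int[lebesgue N]_(x in U) (g x * psi x)%:E)%E.

(* W1 U q u G : u is in W^{1,q}(U), with weak gradient G. *)
Definition W1 U q u (G : 'I_N -> E -> R) : Prop :=
  Lp U q u /\ forall i, Lp U q (G i) /\ weak_partial U i u (G i).

Definition W1norm U q u (G : 'I_N -> E -> R) : \bar R :=
  (LpNorm U q u + \sum_i LpNorm U q (G i))%E.

Definition charge_integral (nu : {charge set E -> \bar R}) f : \bar R :=
  let: exist P hP := cid (Hahn_decomposition nu) in
  let: exist M nuPM := cid hP in
  (\int[jordan_pos nuPM]_x (f x)%:E - \int[jordan_neg nuPM]_x (f x)%:E)%E.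

(* D is the distributional derivative on R^N of the vector-valued w. *)
Definition distr_derivative m (w : 'I_m -> E -> R)
    (D : 'I_m -> 'I_N -> {charge set E -> \bar R}) : Prop :=
  forall k i psi, Ccoo setT psi ->
    (\int[lebesgue N]_x (w k x * partial i psi x)%:E =
     - charge_integral (D k i) psi)%E.

Definition charge_total_variation m (D : 'I_m -> 'I_N -> {charge set E -> \bar R})
    (B : set E) : \bar R :=
  ereal_sup
    [set (\sum_(h <oo)
           (Num.sqrt (\sum_k \sum_i fine (D k i (P h)) ^+ 2))%:E)%E
    | P in [set P : (set E)^nat | [/\ forall h, measurable (P h),
                                     trivIset setT P & \bigcup_h P h = B]]].

Definition boundary U : set E := closure U `\` interior U.

(* Linearity is stated almost everywhere, since T acts on classes of
   functions; ext_ae says that it does. In ext_W1 the operator is restricted to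
   W^{1,q}(U)^m within its domain BV(U)^m, which contains the former when U is
   bounded. Continuity is boundedness of T; all product norms are sums. *)
Record extension_operator U (A : set E) m
    (T : ('I_m -> E -> R) -> ('I_m -> E -> R)) : Prop := {
  ext_ae : forall u v : 'I_m -> E -> R,
    (forall k, BV U (u k)) -> (forall k, BV U (v k)) ->
    (forall k, u k = v k %[ae lebesgue N in U]) ->
    forall k, T u k = T v k %[ae lebesgue N] ;
  ext_linear : forall (a : R) (u v : 'I_m -> E -> R),
    (forall k, BV U (u k)) -> (forall k, BV U (v k)) ->
    forall k, T (fun j x => a * u j x + v j x) k
              = (fun x => a * T u k x + T v k x) %[ae lebesgue N] ;
  ext_BV : forall u : 'I_m -> E -> R, (forall k, BV U (u k)) ->
    forall k, BV setT (T u k) ;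
  ext_continuous : exists C : R, forall u : 'I_m -> E -> R,
    (forall k, BV U (u k)) ->
    (\sum_k BVnorm setT (T u k) <= C%:E * \sum_k BVnorm U (u k))%E ;
  ext_extends : forall u : 'I_m -> E -> R, (forall k, BV U (u k)) ->
    forall k, T u k = u k %[ae lebesgue N in U] ;
  ext_support : forall u : 'I_m -> E -> R, (forall k, BV U (u k)) ->
    forall k, T u k = cst 0 %[ae lebesgue N in ~` A] ;
  ext_boundary : forall u : 'I_m -> E -> R, (forall k, BV U (u k)) ->
    exists2 D, distr_derivative (T u) D & charge_total_variation D (boundary U) = 0 ;
  ext_W1 : forall q, (1 <= q)%E ->
    exists C : R, forall (u : 'I_m -> E -> R) (G : 'I_m -> 'I_N -> E -> R),
      (forall k, BV U (u k)) -> (forall k, W1 U q (u k) (G k)) ->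
      exists2 H : 'I_m -> 'I_N -> E -> R,
        (forall k, W1 setT q (T u k) (H k)) &
        (\sum_k W1norm setT q (T u k) (H k)
         <= C%:E * \sum_k W1norm U q (u k) (G k))%E
}.

Definition BV_extension_domain U : Prop :=
  [/\ open U, bounded_set (boundary U) &
    forall (A : set E) (m : nat), open A -> closure U `<=` A -> (0 < m)%N ->
      exists T, extension_operator U A (m := m) T].

End bounded_variation.

(* Main.v *)
(* A function of bounded variation on R^N is close in L^1, on a cube, to its
   averages over the dyadic boxes of the cube. Halving all boxes of a partition
   in direction i changes the averages, in L^1, by the sum over the boxes of the
   difference of the integrals over the two halves; this is the pairing of the
   function with a step function that is, up to smoothing, the i-th partial
   derivative of a sum of disjoint tents, so it is at most the variation times
   half the side of the boxes. Summing a geometric series, the averages converge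
   in L^1 at a rate controlled by the variation, and the limit is the function
   itself, having the same integrals over all dyadic boxes.
   Extended from Omega to R^N, bounded subsets of BV(Omega) are therefore totally
   bounded in L^1(Omega); by the uniform bound on the (eps,p)-variations, so is
   the given sequence, since L^p(Omega) embeds in L^1(Omega). *)
Require Import Defs.
From HB Require Import structures.
From mathcomp Require Import all_boot all_order all_algebra.
From mathcomp Require Import all_classical all_reals all_analysis.
From mathcomp Require Import measurable_realfun ess_sup_inf.
From mathcomp Require Import ring lra.

Set Implicit Arguments.
Unset Strict Implicit.
Unset Printing Implicit Defensive.

Import Order.TTheory GRing.Theory Num.Theory.
Import numFieldNormedType.Exports.

Local Open Scope classical_set_scope.
Local Open Scope ring_scope.

(** The supremum in [Var] runs over C^1 fields of norm at most 1, whereas the step function to be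
    paired with [w] is discontinuous, and once smoothed the tents of neighbouring boxes overlap. The
    bound by 1 must nevertheless hold for the sum over all boxes, whatever their number. It does
    because all boxes use the same monotone profiles, shifted to their ends: the summands are then
    increments of one product function over boxes, they telescope under halving, and their total is
    a single product of factors in [0, 1]. The same telescoping bounds the smoothed derivatives by
    [h^-1] uniformly, which is what dominated convergence asks for. The BV functions that
    approximate [u n] change with the precision. One ultrafilter finer than [\oo], fixed beforehand,
    serves all precisions at once: the finitely many box integrals converge along it without any
    extraction, and a subsequence is drawn only at the end. *)

(** * Dyadic partitions of a cube *)

Section dyadic_boxes.
Context {R : realType} {N : nat}.
Local Notation E := 'rV[R]_N.
Implicit Types (B C : E * E) (P : seq (E * E)) (i l : 'I_N) (s : seq 'I_N) (x : E) (L : R).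

(** Half-open, so that the two halves of a cell are disjoint and the partition identities hold at
    every point, not just almost everywhere. *)
Definition cell B : set E :=
  [set x | forall l, B.1 ord0 l < x ord0 l <= B.2 ord0 l].

Definition side l B : R := B.2 ord0 l - B.1 ord0 l.

Definition set_coord i (c : R) (x : E) : E :=
  \row_l (if l == i then c else x ord0 l).

Definition mid i B : R := (B.1 ord0 i + B.2 ord0 i) / 2.

Definition lhalf i B : E * E := (B.1, set_coord i (mid i B) B.2).

Definition rhalf i B : E * E := (set_coord i (mid i B) B.1, B.2).

Definition refine i P : seq (E * E) :=
  flatten [seq [:: lhalf i B; rhalf i B] | B <- P].

Definition cube (L : R) : E * E := (const_mx (- L), const_mx L).

(** The list records the directions of the cuts, the latest one at its head; hence [part L (t ++ s)]
    refines [part L s]. *)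
Fixpoint part (L : R) s : seq (E * E) :=
  if s is i :: s' then refine i (part L s') else [:: cube L].

Lemma big_refine (V : nmodType) i P (F : E * E -> V) :
  \sum_(B <- refine i P) F B = \sum_(B <- P) (F (lhalf i B) + F (rhalf i B)).
Proof.
rewrite /refine big_flatten big_map; apply: eq_bigr => B _.
by rewrite big_cons big_seq1.
Qed.

Lemma mem_refine i P C : C \in refine i P ->
  exists2 B, B \in P & C = lhalf i B \/ C = rhalf i B.
Proof.
move=> /flatten_mapP[B BP]; rewrite !inE => /orP[/eqP ->|/eqP ->].
  by exists B => //; left.
by exists B => //; right.
Qed.

Lemma side_half i l B :
  side l (lhalf i B) = (if l == i then side l B / 2 else side l B) /\
  side l (rhalf i B) = (if l == i then side l B / 2 else side l B).
Proof.
by rewrite /side/= !mxE; case: eqVneq => [->|//]; rewrite /mid; split; lra.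
Qed.

Lemma side_part L s l B : B \in part L s ->
  side l B = 2 * L / 2 ^+ count_mem l s.
Proof.
elim: s B => [|i s IH] B /=.
  by rewrite inE => /eqP ->; rewrite /side !mxE divr1; lra.
move=> /mem_refine[C /IH Cl] BC; have [hl hr] := side_half i l C.
have -> : side l B = if l == i then side l C / 2 else side l C.
  by case: BC => ->.
rewrite Cl eq_sym; case: eqP => // _; rewrite add1n exprS invfM; lra.
Qed.

Lemma side_part_ge0 L s l B : 0 <= L -> B \in part L s -> 0 <= side l B.
Proof. by move=> L0 /side_part ->; rewrite divr_ge0 ?mulr_ge0 ?exprn_ge0. Qed.

(** Increment over the box of the product of the [F l], that is, its measure under a product of
    Stieltjes measures. Additivity under halving needs nothing of [F], so one identity serves
    indicators, tents and derivatives of tents. *)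
Definition box_prod (F : 'I_N -> R -> R) B : R :=
  \prod_l (F l (B.2 ord0 l) - F l (B.1 ord0 l)).

Lemma box_prod_lhalf F i B : box_prod F (lhalf i B) =
  (F i (mid i B) - F i (B.1 ord0 i)) *
  \prod_(l | l != i) (F l (B.2 ord0 l) - F l (B.1 ord0 l)).
Proof.
rewrite /box_prod (bigD1 i)//= !mxE eqxx; congr (_ * _).
by apply: eq_bigr => l /negbTE li; rewrite mxE li.
Qed.

Lemma box_prod_rhalf F i B : box_prod F (rhalf i B) =
  (F i (B.2 ord0 i) - F i (mid i B)) *
  \prod_(l | l != i) (F l (B.2 ord0 l) - F l (B.1 ord0 l)).
Proof.
rewrite /box_prod (bigD1 i)//= !mxE eqxx; congr (_ * _).
by apply: eq_bigr => l /negbTE li; rewrite mxE li.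
Qed.

Lemma box_prod_half F i B :
  box_prod F (lhalf i B) + box_prod F (rhalf i B) = box_prod F B.
Proof.
by rewrite box_prod_lhalf box_prod_rhalf /box_prod [RHS](bigD1 i)//=; ring.
Qed.

(* With F l t = k_l (x_l - t) for increasing k_l this is a partition of unity;
   with F l t = (x_l <= t) it says that the cells partition the cube. *)
Lemma box_prod_part F L s :
  \sum_(B <- part L s) box_prod F B = box_prod F (cube L).
Proof.
elim: s => [|i s IH] /=; first by rewrite big_seq1.
by rewrite big_refine -IH; apply: eq_bigr => B _; exact: box_prod_half.
Qed.

(** Nonnegative sides exclude the increment -1, which a reversed interval would give. *)
Lemma box_prod_indic B x : (forall l, 0 <= side l B) ->
  box_prod (fun l t => (x ord0 l <= t)%R%:R) B = \1_(cell B) x.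
Proof.
move=> B0; rewrite indicE; have [xB|xB] := boolP (x \in cell B).
  rewrite /box_prod big1 // => l _.
  by move: xB; rewrite inE => /(_ l) /andP[]; rewrite ltNge => /negbTE -> ->; rewrite subr0.
have [l xl] : exists l, ~~ (B.1 ord0 l < x ord0 l <= B.2 ord0 l).
  apply: contrapT => /forallNP h; move/negP: xB; apply; rewrite inE => l.
  by apply/negPn/negP; exact: h.
rewrite /box_prod (bigD1 l)//=; move: xl (B0 l); rewrite negb_and -leNgt -ltNge subr_ge0.
by case/orP => [xa ab|bx ab];
  rewrite ?xa ?(le_trans xa ab) ?subrr ?mul0r// !leNgt bx (le_lt_trans ab bx) subrr mul0r.
Qed.

Lemma cell_half i B x : (forall l, 0 <= side l B) ->
  \1_(cell (lhalf i B)) x + \1_(cell (rhalf i B)) x = \1_(cell B) x :> R.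
Proof.
move=> B0; rewrite -!box_prod_indic ?box_prod_half// => l;
  have [hl hr] := side_half i l B; rewrite ?hl ?hr; case: eqP => // _;
  by rewrite divr_ge0.
Qed.

Lemma cell_half_sub i B : (forall l, 0 <= side l B) ->
  cell (lhalf i B) `<=` cell B /\ cell (rhalf i B) `<=` cell B.
Proof.
move=> B0; split=> x xB; have := cell_half i x B0; rewrite !indicE (mem_set xB).
  by case: (boolP (x \in cell B)) => [|_]; [rewrite inE|case: (_ \in _) => /= ?; lra].
by case: (boolP (x \in cell B)) => [|_]; [rewrite inE|case: (_ \in _) => /= ?; lra].
Qed.

Lemma cell_part L s x : 0 <= L ->
  \sum_(B <- part L s) \1_(cell B) x = \1_(cell (cube L)) x :> R.
Proof.
move=> L0; rewrite -box_prod_indic => [|l]; last by rewrite /side !mxE; lra.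
rewrite -(box_prod_part _ L s) big_seq [RHS]big_seq; apply: eq_bigr => B BP.
by rewrite box_prod_indic// => l; exact: side_part_ge0 BP.
Qed.

Lemma part_cell_sub L s B : 0 <= L -> B \in part L s -> cell B `<=` cell (cube L).
Proof.
move=> L0; elim: s B => [|i s IH] B /=; first by rewrite inE => /eqP ->.
move=> /mem_refine[C Cs BC]; apply: subset_trans (IH _ Cs).
have C0 l : 0 <= side l C by exact: side_part_ge0 Cs.
by case: BC => ->; have [] := cell_half_sub i C0.
Qed.

Lemma cell_halfI i B : cell (lhalf i B) `&` cell (rhalf i B) = set0.
Proof.
apply/seteqP; split=> // x [/(_ i)/= + /(_ i)/=].
by rewrite !mxE eqxx => /andP[_ h1] /andP[h2 _]; rewrite ltNge h1 in h2.
Qed.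

Lemma part_disjoint L s B C : 0 <= L -> B \in part L s -> C \in part L s ->
  B = C \/ cell B `&` cell C = set0.
Proof.
move=> L0; elim: s B C => [|i s IH] B C /=.
  by rewrite !inE => /eqP -> /eqP ->; left.
move=> /mem_refine[B' B's BB'] /mem_refine[C' C's CC'].
have B0 l : 0 <= side l B' by exact: side_part_ge0 B's.
have C0 l : 0 <= side l C' by exact: side_part_ge0 C's.
have [BC|BC] := IH _ _ B's C's.
  move: CC'; rewrite -BC; case: BB' => -> [->|->]; try by left.
    by right; exact: cell_halfI.
  by right; rewrite setIC; exact: cell_halfI.
right; apply/seteqP; split=> // x [xB xC]; rewrite -BC; split.
  by case: BB' xB => ->; have [h1 h2] := cell_half_sub i B0; [exact: h1|exact: h2].
by case: CC' xC => ->; have [h1 h2] := cell_half_sub i C0; [exact: h1|exact: h2].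
Qed.

Lemma part_nested L s t B C : 0 <= L -> B \in part L s -> C \in part L (t ++ s) ->
  cell C `<=` cell B \/ cell C `&` cell B = set0.
Proof.
move=> L0 Bs; elim: t C => [|i t IH] C /=.
  by move=> /(part_disjoint L0 Bs)[->|]; [left|rewrite setIC; right].
move=> /mem_refine[C' C't CC']; have C0 l : 0 <= side l C' by exact: side_part_ge0 C't.
have CC : cell C `<=` cell C'.
  by case: CC' => ->; have [] := cell_half_sub i C0.
have [h|h] := IH _ C't; [left; exact: subset_trans h|right].
by apply/seteqP; split=> // x [/CC xC xB]; rewrite -h.
Qed.

Lemma cover_part L s x : 0 <= L -> cell (cube L) x ->
  exists2 B, B \in part L s & cell B x.
Proof.
move=> L0 xL; apply: contrapT => h; have := cell_part s x L0.
rewrite [X in _ = X]indicE mem_set// big_seq big1; first by move=> /= ?; lra.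
move=> B Bs; rewrite indicE memNset// => xB; by apply: h; exists B.
Qed.

Lemma measurable_cell B : measurable (cell B).
Proof.
rewrite (_ : cell B = \bigcap_(l : 'I_N) ((fun x : E => x ord0 l)
  @^-1` `]B.1 ord0 l, B.2 ord0 l]%classic)).
  apply: fin_bigcap_measurable => // l _; rewrite -[X in measurable X]setTI.
  exact: measurable_coord.
by apply/seteqP; split=> x /= xP l => [_|]; have:= xP l; rewrite /= in_itv/=; try apply.
Qed.

End dyadic_boxes.

Lemma lebesgue_cell (R : realType) N (B : 'rV[R]_N * 'rV[R]_N) :
  (forall l, 0 <= side l B) -> lebesgue N (cell B) = (\prod_l side l B)%:E.
Proof.
elim: N B => [|N IH] B B0.
  by rewrite big_ord0/= diracE mem_set//= => -[].
rewrite /= /lebesgue_step /pushforward/=.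
pose B' : 'rV[R]_N * 'rV[R]_N :=
  (\row_l B.1 ord0 (lift ord0 l), \row_l B.2 ord0 (lift ord0 l)).
have sB' l : side l B' = side (lift ord0 l) B by rewrite /side !mxE.
rewrite (_ : _ @^-1` _ = `]B.1 ord0 ord0, B.2 ord0 ord0]%classic `*` cell B'); last first.
  apply/seteqP; split=> [y yP|y [y1 y2] l] /=.
    split; first by rewrite /= in_itv/= -cons_rV0; exact: yP.
    by move=> l; rewrite !mxE -cons_rVS; exact: yP.
  case: (unliftP ord0 l) => [j ->|->].
    by rewrite cons_rVS; have := y2 j; rewrite !mxE.
  by rewrite cons_rV0; move: y1; rewrite /= in_itv.
rewrite [LHS]product_measure1E//; last exact: measurable_cell.
rewrite [X in (_ * X)%E = _]IH => [|l]; last by rewrite sB'.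
rewrite big_ord_recl EFinM; congr (_ * _)%E.
  rewrite [LHS]lebesgue_measure_itv /= lte_fin.
  have := B0 ord0; rewrite /side subr_ge0 le_eqVlt => /orP[/eqP <-|->]; last by [].
  by rewrite ltxx subrr.
by congr EFin; apply: eq_bigr => l _; rewrite sB'.
Qed.

(** * C^1 splines: smoothed jumps and ramps *)

Section smooth_steps.
Context {R : realType}.
Implicit Types (f g : R -> R) (y c d h : R).

Definition C1 g g' : Prop :=
  (forall y, is_derive y 1 g (g' y)) /\ continuous g'.

(** A second-order error bound treats the knots of a spline like any other point, without one-sided
    limits. *)
Lemma is_derive_quadratic f d y (C : R) :
  (forall h, `|f (h + y) - f y - h * d| <= C * h ^+ 2) -> is_derive y 1 f d.
Proof.
move=> fC; have C0 : 0 <= C.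
  by have := fC 1; rewrite expr1n mulr1; exact: le_trans.
have fd : h^-1 *: ((f \o shift y) (h *: (1 : R)) - f y) @[h --> 0^'] --> d.
  apply/cvgrPdist_lt => e e0; near=> h.
  have h0 : h != 0 by near: h; exact: nbhs_dnbhs_neq.
  have hn : 0 < `|h| by rewrite normr_gt0.
  rewrite /= /GRing.scale/= mulr1 distrC.
  rewrite (_ : _ - d = h^-1 * (f (h + y) - f y - h * d)); last by field.
  rewrite normrM normfV mulrC ltr_pdivrMr//.
  apply: le_lt_trans (fC h) _; rewrite -real_normK ?num_real// expr2 mulrA ltr_pM2r//.
  (* The denominator is [C + 1] because [C] may be 0. *)
  have he : `|h| < e / (C + 1).
    by near: h; apply: dnbhs0_lt; rewrite divr_gt0// ltr_wpDl.
  by move: he; rewrite ltr_pdivlMr ?ltr_wpDl// => he; nra.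
apply: DeriveDef; first by apply/cvg_ex; exists d.
exact: (cvg_lim _ fd).
Unshelve. all: by end_near. Qed.

Lemma C1_continuous g g' : C1 g g' -> continuous g.
Proof.
move=> [gg' _] y; apply: differentiable_continuous; apply/derivable1_diffP.
exact: ex_derive.
Qed.

Lemma C1B f f' g g' : C1 f f' -> C1 g g' ->
  C1 (fun y => f y - g y) (fun y => f' y - g' y).
Proof.
move=> [ff' cf] [gg' cg]; split=> [y|]; first exact: is_deriveB.
by move=> y; apply: cvgB; [exact: cf|exact: cg].
Qed.

Lemma C1Z c g g' : C1 g g' -> C1 (fun y => c * g y) (fun y => c * g' y).
Proof.
move=> [gg' cg]; split=> [y|]; first exact: is_deriveZ.
by move=> y; apply: cvgMr; exact: cg.
Qed.

Lemma C1_affine c d g g' : C1 g g' ->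
  C1 (fun y => g (c * y + d)) (fun y => g' (c * y + d) * c).
Proof.
move=> [gg' cg]; have aff : forall y : R, is_derive y 1 (fun y => c * y + d) c.
  move=> y; have -> : (fun y => c * y + d) = (c \*: id) + cst d by [].
  by apply: is_derive_eq; rewrite addr0 /GRing.scale/= mulr1.
split=> [y|y].
  exact: (@is_derive1_comp _ _ (fun y => c * y + d)).
apply: cvgMl; apply: (@continuous_comp _ _ _ (fun y => c * y + d) g'); last exact: cg.
by apply: cvgD; [apply: cvgMr; exact: cvg_id|exact: cvg_cst].
Qed.

Lemma C1_ge0_nondecreasing g g' : C1 g g' -> (forall y, 0 <= g' y) ->
  {homo g : y z / y <= z}.
Proof.
move=> gg' g'0 y z yz; have [c _ gc] : exists2 c, c \in `[y, z] & g z - g y = g' c * (z - y).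
  apply: MVT_segment => // [x _|]; first exact: gg'.1.
  by apply: continuous_subspaceT; exact: C1_continuous gg'.
by rewrite -subr_ge0 gc mulr_ge0// subr_ge0.
Qed.

Definition pos y : R := Num.max y 0.

Lemma posE y : pos y = if 0 <= y then y else 0.
Proof. by rewrite /pos; case: (leP 0 y) => // y0; rewrite (max_r (ltW y0)). Qed.

Lemma pos_le0 y : y <= 0 -> pos y = 0.
Proof. by move=> y0; rewrite /pos max_r. Qed.

Lemma pos_ge0 y : 0 <= y -> pos y = y.
Proof. by move=> y0; rewrite /pos max_l. Qed.

Lemma continuous_pos : continuous pos.
Proof. by move=> y; apply: continuous_max; [exact: cvg_id|exact: cvg_cst]. Qed.

Lemma C1_pos2 : C1 (fun y => pos y ^+ 2) (fun y => 2 * pos y).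
Proof.
split=> [y|y]; last by apply: cvgMr; exact: continuous_pos.
apply: (@is_derive_quadratic _ _ _ 1) => h; rewrite mul1r !posE ler_norml.
by apply/andP; case: (leP 0 (h + y)) => ?; case: (leP 0 y) => ?; split; nra.
Qed.

Lemma C1_pos3 : C1 (fun y => pos y ^+ 3) (fun y => 3 * pos y ^+ 2).
Proof.
split=> [y|y]; last by apply: cvgMr; exact: (C1_continuous C1_pos2).
have -> : (fun y => pos y ^+ 3) = id * (fun y => pos y ^+ 2).
  apply/funext => z; rewrite /GRing.mul/= posE; case: ifP => _; rewrite ?expr0n ?mulr0//.
apply: is_derive_eq; first by apply: is_deriveM; exact: C1_pos2.1.
by rewrite /GRing.scale/= !posE; case: ifP => _; ring.
Qed.

(* Quadratic spline rising from 0 to 1 on [0, 2], with primitive ramp. *)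
Definition step y : R :=
  2^-1 * (pos y ^+ 2 - pos (y - 1) ^+ 2 - (pos (y - 1) ^+ 2 - pos (y - 2) ^+ 2)).

Definition dstep y : R := pos y - pos (y - 1) - (pos (y - 1) - pos (y - 2)).

Definition ramp y : R :=
  6^-1 * (pos y ^+ 3 - pos (y - 1) ^+ 3 - (pos (y - 1) ^+ 3 - pos (y - 2) ^+ 3)).

Lemma C1_shift c g g' : C1 g g' -> C1 (fun y => g (y - c)) (fun y => g' (y - c)).
Proof.
by move=> /(@C1_affine 1 (- c)); congr C1; apply/funext => y; rewrite mul1r ?mulr1.
Qed.

Lemma C1_second_difference g g' : C1 g g' ->
  C1 (fun y => g y - g (y - 1) - (g (y - 1) - g (y - 2)))
     (fun y => g' y - g' (y - 1) - (g' (y - 1) - g' (y - 2))).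
Proof.
move=> gg'; apply: (@C1B (fun y => g y - g (y - 1)) _ (fun y => g (y - 1) - g (y - 2))).
  by apply: C1B => //; exact: C1_shift.
by apply: (@C1B (fun y => g (y - 1)) _ (fun y => g (y - 2))); exact: C1_shift.
Qed.

Lemma C1_step : C1 step dstep.
Proof.
have := C1Z 2^-1 (C1_second_difference C1_pos2).
by congr C1; apply/funext => y; rewrite /dstep; lra.
Qed.

Lemma C1_ramp : C1 ramp step.
Proof.
have := C1Z 6^-1 (C1_second_difference C1_pos3).
by congr C1; apply/funext => y; rewrite /step; lra.
Qed.

Lemma step_nondecreasing : {homo step : y z / y <= z}.
Proof.
apply: (C1_ge0_nondecreasing C1_step) => y; rewrite /dstep !posE.
by case: (leP 0 y) => ?; case: (leP 0 (y - 1)) => ?; case: (leP 0 (y - 2)) => ?; lra.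
Qed.

Lemma step_le0 y : y <= 0 -> step y = 0.
Proof.
by move=> y0; rewrite /step !pos_le0 ?expr0n//=; lra.
Qed.

Lemma step_ge2 y : 2 <= y -> step y = 1.
Proof.
by move=> y2; rewrite /step !pos_ge0; [field|lra..].
Qed.

Lemma ramp_le0 y : y <= 0 -> ramp y = 0.
Proof.
by move=> y0; rewrite /ramp !pos_le0 ?expr0n//=; lra.
Qed.

Lemma ramp_ge2 y : 2 <= y -> ramp y = y - 1.
Proof.
by move=> y2; rewrite /ramp !pos_ge0; [field|lra..].
Qed.

Definition stepn (n : nat) y : R := step (n.+1%:R * y).

Definition dstepn (n : nat) y : R := n.+1%:R * dstep (n.+1%:R * y).

(** Smoothing of the function that rises linearly from 0 to 1 on [0, h]; its derivative [drampn]
    tends to [h^-1] times the indicator of ]0, h]. Two of these at distance [h] make a tent with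
    base [2 * h]. *)
Definition rampn (n : nat) h y : R :=
  (n.+1%:R * h)^-1 * (ramp (n.+1%:R * y) - ramp (n.+1%:R * (y - h))).

Definition drampn (n : nat) h y : R := h^-1 * (stepn n y - stepn n (y - h)).

Lemma C1_stepn n : C1 (stepn n) (dstepn n).
Proof.
have := C1_affine n.+1%:R 0 C1_step.
by congr C1; apply/funext => y; rewrite /stepn/dstepn addr0// mulrC.
Qed.

Lemma C1_rampn n h : C1 (rampn n h) (drampn n h).
Proof.
have rr : C1 (fun y => ramp (n.+1%:R * y)) (fun y => n.+1%:R * stepn n y).
  have := C1_affine n.+1%:R 0 C1_ramp.
  by congr C1; apply/funext => y; rewrite /stepn addr0// mulrC.
have := C1Z (n.+1%:R * h)^-1 (C1B rr (C1_shift h rr)).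
congr C1; apply/funext => y; rewrite /drampn -mulrBr invfM mulrACA.
by rewrite mulVf ?pnatr_eq0// mul1r.
Qed.

Lemma stepn_nondecreasing n : {homo stepn n : y z / y <= z}.
Proof. by move=> y z yz; apply: step_nondecreasing; rewrite ler_pM2l. Qed.

Lemma stepn_le0 n y : y <= 0 -> stepn n y = 0.
Proof. by move=> y0; rewrite /stepn step_le0// pmulr_rle0. Qed.

Lemma stepn_ge2 n y : 2 <= y -> stepn n y = 1.
Proof.
move=> y2; rewrite /stepn step_ge2// (le_trans y2)// ler_peMl ?ler1n//.
by rewrite (le_trans _ y2).
Qed.

Lemma stepn01 n y : 0 <= stepn n y <= 1.
Proof.
apply/andP; split.
  rewrite -(@stepn_le0 n (Num.min y 0)) ?ge_min ?lexx ?orbT//.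
  by apply: stepn_nondecreasing; rewrite ge_min lexx.
rewrite -(@stepn_ge2 n (Num.max y 2)) ?le_max ?lexx ?orbT//.
by apply: stepn_nondecreasing; rewrite le_max lexx.
Qed.

(** At each point the values are eventually constant, for [y > 0] as soon as [n.+1 >= 2 / y]. The
    limit is 0 at [y = 0], in accordance with the left-open cells. *)
Lemma near_stepn y : \forall n \near \oo, stepn n y = (0 < y)%R%:R.
Proof.
have [y0|y0] := leP y 0; first by apply: nearW => n; exact: stepn_le0.
near=> n; rewrite /stepn step_ge2// -ler_pdivrMr//.
apply: (@le_trans _ _ n%:R); last by rewrite ler_nat.
by near: n; exact: nbhs_infty_ger.
Unshelve. all: by end_near. Qed.

Lemma rampn_nondecreasing n h : 0 < h -> {homo rampn n h : y z / y <= z}.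
Proof.
move=> h0; apply: (C1_ge0_nondecreasing (C1_rampn n h)) => y.
rewrite /drampn mulr_ge0 ?invr_ge0 ?(ltW h0)// subr_ge0.
by apply: stepn_nondecreasing; lra.
Qed.

Lemma rampn_le0 n h y : 0 < h -> y <= 0 -> rampn n h y = 0.
Proof.
by move=> h0 y0; rewrite /rampn !ramp_le0 ?subrr ?mulr0// pmulr_rle0//; lra.
Qed.

(** Beyond 2 the function [ramp] has slope 1, so the difference of its two values is exactly the
    normalising factor. *)
Lemma rampn_ge n h y : 0 < h -> 2 + h <= y -> rampn n h y = 1.
Proof.
move=> h0 y2; have n1 : 1 <= n.+1%:R :> R by rewrite ler1n.
rewrite /rampn !ramp_ge2; [|nra|nra].
rewrite (_ : _ - 1 - _ = n.+1%:R * h); last by ring.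
by rewrite mulVf// mulf_neq0 ?pnatr_eq0// gt_eqF.
Qed.

Lemma rampn01 n h y : 0 < h -> 0 <= rampn n h y <= 1.
Proof.
move=> h0; apply/andP; split.
  rewrite -(@rampn_le0 n h (Num.min y 0)) ?ge_min ?lexx ?orbT//.
  by apply: rampn_nondecreasing; rewrite // ge_min lexx.
rewrite -(@rampn_ge n h (Num.max y (2 + h))) ?le_max ?lexx ?orbT//.
by apply: rampn_nondecreasing; rewrite // le_max lexx.
Qed.

End smooth_steps.

(** * Sums of tensor products as test fields *)

Section tensor_fields.
Context {R : realType} {N : nat}.
Local Notation E := 'rV[R]_N.
Implicit Types (h dh : 'I_N -> R -> R) (x v : E) (i j l : 'I_N) (f : E -> R).

Definition tensor h x : R := \prod_l h l (x ord0 l).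

Definition dtensor h dh j x : R :=
  dh j (x ord0 j) * \prod_(l | l != j) h l (x ord0 l).

Lemma differentiable_tensor h dh x : (forall l, C1 (h l) (dh l)) ->
  differentiable (tensor h) x.
Proof.
move=> hdh; rewrite /tensor; elim: (index_enum _) => [|l r IH].
  by rewrite (_ : (fun _ => _) = cst 1)//; apply/funext => y; rewrite big_nil.
rewrite (_ : (fun _ => _) = (h l \o (fun y : E => y ord0 l)) *
    (fun y : E => \prod_(l <- r) h l (y ord0 l))); last first.
  by apply/funext => y; rewrite big_cons.
apply: differentiableM => //; apply: differentiable_comp.
  exact: differentiable_coord.
by apply/derivable1_diffP; apply: ex_derive; exact: (hdh l).1.
Qed.

Lemma is_derive_line f x v (d : R) :
  is_derive (0 : R) 1 (fun t => f (t *: v + x)) d -> is_derive x v f d.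
Proof.
have e : (fun t : R => t^-1 *: ((f \o shift x) (t *: v) - f x)) =
    (fun t : R => t^-1 *: (((fun t => f (t *: v + x)) \o shift 0) (t *: 1) -
       f (0 *: v + x))).
  apply/funext => t; rewrite /=; congr (_ *: (f _ - f _)).
    by rewrite addr0 /GRing.scale/= mulr1.
  by rewrite scale0r add0r.
by move=> [df fd]; apply: DeriveDef; [rewrite /derivable|rewrite /derive]; rewrite e.
Qed.

Lemma is_derive_tensor h dh j x : (forall l, C1 (h l) (dh l)) ->
  is_derive x (delta_mx ord0 j) (tensor h) (dtensor h dh j x).
Proof.
move=> hdh; apply: is_derive_line.
pose C := \prod_(l | l != j) h l (x ord0 l).
rewrite (_ : (fun _ => _) = (fun t : R => C * h j (1 * t + x ord0 j))); last first.
  apply/funext => t; rewrite /tensor (bigD1 j)//= !mxE !eqxx/= mulr1 mul1r mulrC.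
  congr (_ * _); apply: eq_bigr => l lj.
  by rewrite !mxE/= (negbTE lj) mulr0 add0r.
have := (C1Z C (C1_affine 1 (x ord0 j) (hdh j))).1 0.
by rewrite mulr0 add0r mulr1 mulrC.
Qed.

Lemma continuous_prod_coord (P : pred 'I_N) h : (forall l, continuous (h l)) ->
  continuous (fun x => \prod_(l | P l) h l (x ord0 l)).
Proof.
move=> ch x; apply: (@cvg_big R _ _ _ _ (@mul_continuous R) _ (nbhs x)) => l _.
apply: (@continuous_comp _ _ _ (fun x : E => x ord0 l) (h l)); last exact: ch.
exact: coord_continuous.
Qed.

Lemma continuous_dtensor h dh j : (forall l, C1 (h l) (dh l)) ->
  continuous (dtensor h dh j).
Proof.
move=> hdh x; apply: (@cvgM _ _ (nbhs x) _ (fun x => dh j (x ord0 j))); last first.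
  by apply: continuous_prod_coord => l; exact: C1_continuous (hdh l).
apply: (@continuous_comp _ _ _ (fun x : E => x ord0 j) (dh j)); last exact: (hdh j).2.
exact: coord_continuous.
Qed.

Section linear_combination.
Variables (T : Type) (s : seq T) (c : T -> R) (h dh : T -> 'I_N -> R -> R).
Hypothesis hdh : forall B l, C1 (h B l) (dh B l).
Let Phi x := \sum_(B <- s) c B * tensor (h B) x.

Lemma is_derive_sum_tensor j x : is_derive x (delta_mx ord0 j) Phi
  (\sum_(B <- s) c B * dtensor (h B) (dh B) j x).
Proof.
rewrite /Phi; elim: s => [|B r IH].
  rewrite big_nil (_ : (fun _ => _) = cst 0); first exact: is_derive_cst.
  by apply/funext => y; rewrite big_nil.
rewrite big_cons (_ : (fun _ => _) = (c B \*: tensor (h B)) +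
    (fun y : E => \sum_(B <- r) c B * tensor (h B) y)); last first.
  by apply/funext => y; rewrite big_cons.
by apply: is_deriveD => //; apply: is_deriveZ; exact: is_derive_tensor.
Qed.

Lemma Ck_sum_tensor : Ck 1 Phi.
Proof.
split=> [x|j].
  rewrite /Phi; elim: s => [|B r IH].
    by rewrite (_ : (fun _ => _) = cst 0)//; apply/funext => y; rewrite big_nil.
  rewrite (_ : (fun _ => _) = (c B \*: tensor (h B)) +
      (fun y : E => \sum_(B <- r) c B * tensor (h B) y)); last first.
    by apply/funext => y; rewrite big_cons.
  by apply: differentiableD => //; apply: differentiableZ; exact: differentiable_tensor.
rewrite /= (_ : partial j Phi = fun x => \sum_(B <- s) c B * dtensor (h B) (dh B) j x).
  move=> x; apply: (@cvg_big R _ _ _ _ (@add_continuous R) _ (nbhs x)) => B _.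
  by apply: cvgMr; exact: continuous_dtensor.
by apply/funext => x; apply: derive_val; exact: is_derive_sum_tensor.
Qed.

End linear_combination.

Lemma Ck1_cst0 : Ck 1 (cst 0 : E -> R).
Proof.
split=> [x|i]; first exact: differentiable_cst.
rewrite /= (_ : partial i _ = cst 0); first exact: cst_continuous.
by apply/funext => x; rewrite /partial derive_cst.
Qed.

Lemma Cck1_cst0 (U : set E) : Cck U 1 (cst 0).
Proof.
have s0 : supp (cst 0 : E -> R) = set0.
  by rewrite /supp (_ : [set _ | _] = set0) ?closure0//; apply/seteqP; split=> x //=; rewrite eqxx.
by split; [exact: Ck1_cst0|rewrite s0; exact: compact0|rewrite s0; exact: sub0set].
Qed.

Lemma Var_ge0 (U : set E) f : (0 <= Var U f)%E.
Proof.
apply: ereal_sup_ubound; exists (fun=> cst 0).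
  split=> [i|x]; first exact: Cck1_cst0.
  by rewrite big1 ?sqrtr0// => i _; rewrite expr0n.
rewrite integral0_eq// => x _; rewrite /divergence big1 ?mulr0// => i _.
by rewrite /partial derive_cst.
Qed.

(** With one nonzero component the Euclidean norm of the field is [|f|], and the closure of the
    points where [f] is nonzero stays in a closed ball, hence is compact. *)
Lemma test_field_single i f (M : R) : Ck 1 f ->
  (forall x, f x != 0 -> `|x| <= M) -> (forall x, `|f x| <= 1) ->
  test_field setT (fun j => if j == i then f else cst 0).
Proof.
move=> f1 fM f_le1; split=> [j|x].
  case: eqP => _; last exact: Cck1_cst0.
  split=> //.
  apply: bounded_closed_compact; last exact: closed_closure.
  exists M; split; first exact: num_real.
  move=> M' MM' x fx; apply/ltW; apply: le_lt_trans MM'.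
  have cM : closed [set y : E | `|y| <= M].
    rewrite (_ : [set _ | _] = (fun y : E => `|y|) @^-1` [set r | r <= M])//.
    apply: closed_comp; last exact: closed_le.
    by move=> y _; exact: norm_continuous.
  have : closure [set y : E | `|y| <= M] x by move: x fx; exact: closure_subset fM.
  by rewrite -(closure_id _).1.
rewrite (bigD1 i)//= eqxx big1 ?addr0; last by move=> j /negbTE ->; rewrite expr0n.
by rewrite sqrtr_sqr.
Qed.

Lemma divergence_single i f x :
  divergence (fun j => if j == i then f else cst 0) x = partial i f x.
Proof.
rewrite /divergence (bigD1 i)//= eqxx big1 ?addr0// => j /negbTE ->.
by rewrite /partial derive_cst.
Qed.

End tensor_fields.

(** * Integrals of finite sums and of restrictions *)

Section real_integral.
Context d (T : measurableType d) (R : realType).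
Variable mu : {measure set T -> \bar R}.
Implicit Types (f g : T -> R) (A D : set T).

Lemma integrable_Rsum (I : Type) (s : seq I) (F : I -> T -> R) D :
  measurable D -> (forall i, mu.-integrable D (EFin \o F i)) ->
  mu.-integrable D (EFin \o (fun x => \sum_(i <- s) F i x)).
Proof.
move=> mD iF; rewrite (_ : _ \o _ = fun x => (\sum_(i <- s) (EFin \o F i) x)%E).
  by apply: integrable_sum => // i _; exact: iF.
by apply/funext => x; rewrite /= sumEFin.
Qed.

Lemma Rintegral_sum (I : Type) (s : seq I) (F : I -> T -> R) D :
  measurable D -> (forall i, mu.-integrable D (EFin \o F i)) ->
  \int[mu]_(x in D) (\sum_(i <- s) F i x) = \sum_(i <- s) \int[mu]_(x in D) F i x.
Proof.
move=> mD iF; elim: s => [|i s IH].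
  by under eq_Rintegral do rewrite big_nil; rewrite big_nil Rintegral_cst// mul0r.
under eq_Rintegral do rewrite big_cons.
by rewrite big_cons RintegralD ?IH//; exact: integrable_Rsum.
Qed.

Lemma integrable_indicMr f A : measurable A -> mu.-integrable setT (EFin \o f) ->
  mu.-integrable setT (EFin \o (fun x => f x * \1_A x)).
Proof.
move=> mA fi; rewrite (_ : _ \o _ = (EFin \o f) \* (EFin \o \1_A))%E.
  apply: integrableMl => //; exists 1; split=> // M M1 x _ /=.
  by rewrite indicE; case: (_ \in _); rewrite ?normr1 ?normr0 ltW// (lt_trans _ M1).
by apply/funext => x; rewrite /= EFinM.
Qed.

Lemma Rintegral_indic f A : \int[mu]_(x in A) f x = \int[mu]_x (f x * \1_A x).
Proof.
rewrite Rintegral_mkcond; apply: eq_Rintegral => x _.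
by rewrite patchE indicE; case: (_ \in _); rewrite ?mulr1 ?mulr0.
Qed.

End real_integral.

(** * Pairing with Haar functions is controlled by the variation *)

Section variation_of_averages.
Context {R : realType} {N : nat}.
Local Notation E := 'rV[R]_N.
Local Notation mu := (lebesgue N : {measure set E -> \bar R}).
Implicit Types (B : E * E) (w : E -> R) (i l : 'I_N) (s : seq 'I_N) (x : E).

Definition cint w B : R := \int[mu]_(x in cell B) w x.

Section test_functions.
Variables (L h : R) (i : 'I_N) (s : seq 'I_N) (c : E * E -> R).
Hypotheses (L0 : 0 < L) (h0 : 0 < h).
Hypothesis side_h : forall B, B \in part L s -> side i B = 2 * h.
Hypothesis c1 : forall B, `|c B| <= 1.

(** Ramps in the direction of the cut, smoothed jumps in the others. The profile does not depend on
    the box, because by [side_h] all boxes have the same side in direction [i]; this is what lets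
    the sum over boxes telescope. *)
Let k n l : R -> R := if l == i then rampn n h else stepn n.

Let dk n l : R -> R := if l == i then drampn n h else dstepn n.

Let C1k n l : C1 (k n l) (dk n l).
Proof. by rewrite /k /dk; case: eqP => _; [exact: C1_rampn|exact: C1_stepn]. Qed.

Let k_nd n l : {homo k n l : y z / y <= z}.
Proof.
by rewrite /k; case: eqP => _; [exact: rampn_nondecreasing|exact: stepn_nondecreasing].
Qed.

Let k01 n l (y : R) : 0 <= k n l y <= 1.
Proof. by rewrite /k; case: eqP => _; [exact: rampn01|exact: stepn01]. Qed.

Let k_le0 n l (y : R) : y <= 0 -> k n l y = 0.
Proof. by rewrite /k; case: eqP => _; [exact: rampn_le0|exact: stepn_le0]. Qed.

Let k_ge n l (y : R) : 2 + h <= y -> k n l y = 1.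
Proof.
rewrite /k; case: eqP => _ hy; first exact: rampn_ge.
by apply: stepn_ge2; apply: le_trans hy; rewrite lerDl ltW.
Qed.

(** The ends are those of the left half: in direction [i] a ramp of width [h] from the left end
    minus one from the midpoint is, up to smoothing, the tent over the whole side [2 * h]. In the
    other directions [lhalf i B] and [B] have the same ends. *)
Let hB n B l (y : R) : R :=
  k n l (y - (lhalf i B).1 ord0 l) - k n l (y - (lhalf i B).2 ord0 l).

Let dhB n B l (y : R) : R :=
  dk n l (y - (lhalf i B).1 ord0 l) - dk n l (y - (lhalf i B).2 ord0 l).

Let C1hB n B l : C1 (hB n B l) (dhB n B l).
Proof.
by apply: (@C1B _ (fun y => k n l (y - _)) _ (fun y => k n l (y - _))); apply: C1_shift.
Qed.

(* Smoothed sum of tents supported in the boxes: in direction i each summand is a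
   difference of two steps of width h, in the others a smoothed indicator. *)
Definition bump n x : R := \sum_(B <- part L s) c B * tensor (hB n B) x.

Let K n x l (t : R) : R := - k n l (x ord0 l - t).

Let tensorE n B x : tensor (hB n B) x = box_prod (K n x) (lhalf i B).
Proof. by apply: eq_bigr => l _; rewrite /hB /K; ring. Qed.

Let box_prod_ge0 n x B : (forall l, 0 <= side l B) -> 0 <= box_prod (K n x) B.
Proof.
move=> B0; apply: prodr_ge0 => l _; rewrite /K opprK addrC subr_ge0.
by apply: k_nd; rewrite lerD2l lerN2 -subr_ge0; exact: B0.
Qed.

(** The nonnegative terms of the right halves are added to those of the left halves, after which
    [box_prod_part] collapses the sum to one product over the cube. This replaces disjointness of
    the supports, which smoothing destroys. *)
Let le_bump n x : `|bump n x| <= box_prod (K n x) (cube L).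
Proof.
rewrite /bump -(box_prod_part _ L s); apply: le_trans (ler_norm_sum _ _ _) _.
rewrite big_seq [leRHS]big_seq; apply: ler_sum => B BP.
have B0 l : 0 <= side l B by exact: side_part_ge0 (ltW L0) BP.
have lB0 l : 0 <= side l (lhalf i B).
  by have [-> _] := side_half i l B; case: eqP => // _; rewrite divr_ge0.
have rB0 l : 0 <= side l (rhalf i B).
  by have [_ ->] := side_half i l B; case: eqP => // _; rewrite divr_ge0.
rewrite tensorE normrM (ger0_norm (box_prod_ge0 _ _ lB0)) -(box_prod_half _ i B).
have := box_prod_ge0 n x rB0; have := box_prod_ge0 n x lB0; have := c1 B.
by have := normr_ge0 (c B); nra.
Qed.

Let subL_le_addL (y : R) : y - L <= y + L.
Proof. by rewrite lerD2l ge0_cp// ltW. Qed.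

Let cube_factor n x l : 0 <= k n l (x ord0 l + L) - k n l (x ord0 l - L) <= 1.
Proof.
apply/andP; split; first by rewrite subr_ge0; exact: k_nd.
have /andP[h1 h2] := k01 n l (x ord0 l + L); have /andP[h3 h4] := k01 n l (x ord0 l - L).
lra.
Qed.

Let box_prod_cube n x : box_prod (K n x) (cube L) =
  \prod_l (k n l (x ord0 l + L) - k n l (x ord0 l - L)).
Proof. by apply: eq_bigr => l _; rewrite /K !mxE opprK addrC opprK. Qed.

Let bump_le1 n x : `|bump n x| <= 1.
Proof.
apply: le_trans (le_bump n x) _; rewrite box_prod_cube.
by apply: prodr_ile1 => l _; exact: cube_factor.
Qed.

(** Smoothing shifts the profiles to the right by an amount bounded uniformly in [n], so the tents
    may leave the cube, but not by more than [2 + h]. Farther out, some factor of the product over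
    the cube is [0 - 0] or [1 - 1]. *)
Let bump_support n x : bump n x != 0 -> `|x| <= L + 2 + h.
Proof.
have [L1 h1] : 0 < L /\ 0 < h by [].
move=> bx; apply: contrapT => /negP; rewrite -ltNge => xL; move/negP: bx; apply.
have [l xl] : exists l, L + 2 + h < `|x ord0 l|.
  have : `|x| != 0 by rewrite gt_eqF// (lt_trans _ xL)//; lra.
  move=> /mx_norm_neq0[[a l] /= nx]; exists l; move: xL; rewrite /Num.norm/= nx.
  by rewrite (ord1 a).
rewrite -normr_le0; apply: le_trans (le_bump n x) _.
rewrite box_prod_cube (bigD1 l)//= (_ : k _ _ _ - _ = 0) ?mul0r//.
move: xl; rewrite ltr_normr => /orP[xl|xl].
  by rewrite !k_ge ?subrr//; lra.
by rewrite !k_le0 ?subrr//; lra.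
Qed.

Lemma test_field_bump n :
  test_field setT (fun j => if j == i then bump n else cst 0).
Proof.
have bump1 : Ck 1 (bump n) by exact: (Ck_sum_tensor _ _ (C1hB n)).
exact: (test_field_single i bump1 (@bump_support n) (bump_le1 n)).
Qed.

Let G n x l (t : R) : R := - stepn n (x ord0 l - t).

(** In direction [i] the derivative is a second difference of smoothed jumps with spacing [h]; by
    [side_h] its nodes are the ends and the midpoint of the box, whence left half minus right
    half. *)
Let partial_bumpE n x : partial i (bump n) x =
  h^-1 * \sum_(B <- part L s) c B *
    (box_prod (G n x) (lhalf i B) - box_prod (G n x) (rhalf i B)).
Proof.
have -> : partial i (bump n) x = \sum_(B <- part L s) c B * dtensor (hB n B) (dhB n B) i x.
  by apply: derive_val; exact: is_derive_sum_tensor.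
rewrite mulr_sumr big_seq [RHS]big_seq; apply: eq_bigr => B BP.
rewrite [RHS]mulrCA; congr (_ * _).
rewrite /dtensor box_prod_lhalf box_prod_rhalf -mulrBl mulrA; congr (_ * _).
  rewrite /dhB /dk eqxx /drampn !mxE eqxx -mulrBr; congr (_ * _).
  have sB := side_h BP; rewrite /side in sB.
  rewrite (_ : _ - B.1 ord0 i - h = x ord0 i - mid i B); last by rewrite /mid; lra.
  rewrite (_ : _ - mid i B - h = x ord0 i - B.2 ord0 i); last by rewrite /mid; lra.
  by rewrite /G; lra.
by apply: eq_bigr => l /negbTE li; rewrite /hB /k li /G !mxE li; lra.
Qed.

Let boxG_ge0 n x B : (forall l, 0 <= side l B) -> 0 <= box_prod (G n x) B.
Proof.
move=> B0; apply: prodr_ge0 => l _; rewrite /G opprK addrC subr_ge0.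
by apply: stepn_nondecreasing; rewrite lerD2l lerN2 -subr_ge0; exact: B0.
Qed.

(** Both halves contribute nonnegative terms, so their difference is at most their sum, and the sums
    telescope to the cube as in [le_bump]. *)
Lemma partial_bump_le n x : `|partial i (bump n) x| <= h^-1.
Proof.
rewrite partial_bumpE normrM gtr0_norm ?invr_gt0// ler_piMr ?invr_ge0 ?(ltW h0)//.
apply: (@le_trans _ _ (box_prod (G n x) (cube L))); last first.
  apply: prodr_ile1 => l _; rewrite /G !mxE.
  have /andP[h1 h2] := stepn01 n (x ord0 l + L).
  have /andP[h3 h4] := stepn01 n (x ord0 l - L).
  have : stepn n (x ord0 l - L) <= stepn n (x ord0 l + L).
    exact: stepn_nondecreasing.
  by rewrite !opprK => ?; lra.
rewrite -(box_prod_part _ L s); apply: le_trans (ler_norm_sum _ _ _) _.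
rewrite big_seq [leRHS]big_seq; apply: ler_sum => B BP.
have B0 l : 0 <= side l B by exact: side_part_ge0 (ltW L0) BP.
have lB0 l : 0 <= side l (lhalf i B).
  by have [-> _] := side_half i l B; case: eqP => // _; rewrite divr_ge0.
have rB0 l : 0 <= side l (rhalf i B).
  by have [_ ->] := side_half i l B; case: eqP => // _; rewrite divr_ge0.
rewrite normrM -(box_prod_half _ i B).
apply: le_trans (ler_pM _ _ (c1 B) (lexx _)) _ => //; rewrite mul1r.
apply: le_trans (ler_normB _ _) _.
by rewrite !ger0_norm//; exact: boxG_ge0.
Qed.

Let near_boxG x B : (forall l, 0 <= side l B) ->
  \forall n \near \oo, box_prod (G n x) B = \1_(cell B) x.
Proof.
move=> B0; rewrite -box_prod_indic//.
suff : \forall n \near \oo, forall l,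
    G n x l (B.2 ord0 l) - G n x l (B.1 ord0 l) =
    (x ord0 l <= B.2 ord0 l)%R%:R - (x ord0 l <= B.1 ord0 l)%R%:R.
  by apply: filterS => n h1; apply: eq_bigr => l _; exact: h1.
apply: filter_forall => l; have h1 := near_stepn (x ord0 l - B.1 ord0 l).
apply: filterS2 (near_stepn (x ord0 l - B.2 ord0 l)) h1 => n.
rewrite /G => -> ->; rewrite !subr_gt0 !leNgt.
by case: (_ < _); case: (_ < _) => /=; lra.
Qed.

Lemma cvg_partial_bump x : partial i (bump n) x @[n --> \oo] -->
  h^-1 * \sum_(B <- part L s) c B * (\1_(cell (lhalf i B)) x - \1_(cell (rhalf i B)) x).
Proof.
under eq_fun do rewrite partial_bumpE big_seq.
rewrite big_seq; apply: cvgMr; apply: (@cvg_big R _ _ _ _ (@add_continuous R)) => B BP.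
have B0 l : 0 <= side l B by exact: side_part_ge0 (ltW L0) BP.
apply: cvgMr; apply: cvgB; apply: cvg_near_cst; apply: near_boxG => l.
  by have [-> _] := side_half i l B; case: eqP => // _; rewrite divr_ge0.
by have [_ ->] := side_half i l B; case: eqP => // _; rewrite divr_ge0.
Qed.

Let partial_bump_measurable n : measurable_fun setT (partial i (bump n)).
Proof.
have -> : partial i (bump n) = fun x => h^-1 * \sum_(B <- part L s) c B *
    (box_prod (G n x) (lhalf i B) - box_prod (G n x) (rhalf i B)).
  by apply/funext => x; exact: partial_bumpE.
have mG B : measurable_fun setT (fun x => box_prod (G n x) B).
  apply: measurable_prod => l _; rewrite /G.
  have mS (b : R) : measurable_fun setT (fun x : E => stepn n (x ord0 l - b)).
    apply: (measurableT_comp (f := stepn n)).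
      by apply: continuous_measurable_fun; exact: C1_continuous (C1_stepn n).
    by apply: measurable_funB => //; exact: measurable_coord.
  by apply: measurable_funB; apply: measurableT_comp.
apply: measurable_funM => //; apply: measurable_sum => B.
by apply: measurable_funM => //; apply: measurable_funB.
Qed.

Lemma haar_pairing_le w (V : R) : mu.-integrable setT (EFin \o w) ->
  (Var setT w <= V%:E)%E ->
  \sum_(B <- part L s) c B * (cint w (lhalf i B) - cint w (rhalf i B)) <= h * V.
Proof.
move=> wi VV; have mw : measurable_fun setT w.
  by apply/measurable_EFinP; exact: measurable_int wi.
pose psi x := h^-1 * \sum_(B <- part L s) c B *
  (\1_(cell (lhalf i B)) x - \1_(cell (rhalf i B)) x).
pose F n x := (w x * partial i (bump n) x)%:E.
(* Every smoothing index gives an admissible field, so the bound by [V] passes to the limit;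
   [h^-1 * |w|] dominates by [partial_bump_le]. The factor [h] of the conclusion undoes the slope
   [h^-1] of the tents. *)
have [] := @dominated_convergence _ _ _ mu setT measurableT F
  (fun x => (w x * psi x)%:E) (fun x => (h^-1)%:E * `|(w x)%:E|)%E.
- by move=> n; apply/measurable_EFinP; exact: measurable_funM.
- apply/measurable_EFinP; apply: measurable_funM => //; rewrite /psi.
  apply: measurable_funM => //; apply: measurable_sum => B.
  by apply: measurable_funM => //; apply: measurable_funB;
    apply: measurable_indic; exact: measurable_cell.
- apply: aeW => x _; apply: cvg_EFin; first exact: nearW.
  by apply: cvgMr; exact: cvg_partial_bump.
- by apply: integrableZl => //; exact: integrable_abse.
- apply: aeW => x n _; rewrite /F/= -EFinM lee_fin normrM mulrC.
  by rewrite ler_wpM2r//; exact: partial_bump_le.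
move=> iwpsi _ /(_ _) cF.
have : (\int[mu]_x (w x * psi x)%:E <= V%:E)%E.
  rewrite -(cvg_lim _ cF)//; apply: lime_le; first by apply/cvg_ex; eexists; exact: cF.
  apply: nearW => n; apply: le_trans VV; apply: ereal_sup_ubound.
  exists (fun j => if j == i then bump n else cst 0); first exact: test_field_bump.
  by apply: eq_integral => x _; rewrite divergence_single.
move=> h1; rewrite -ler_pdivrMl// -lee_fin; apply: le_trans h1.
rewrite le_eqVlt; apply/orP; left; apply/eqP.
have iw B : mu.-integrable setT (EFin \o (fun x => w x * \1_(cell B) x)).
  by apply: integrable_indicMr => //; exact: measurable_cell.
have iwc B : mu.-integrable setT (EFin \o (fun x => c B *
    (w x * \1_(cell (lhalf i B)) x - w x * \1_(cell (rhalf i B)) x))).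
  apply: (@integrableZl _ _ _ _ _ measurableT (c B) (EFin \o (fun x =>
    w x * \1_(cell (lhalf i B)) x - w x * \1_(cell (rhalf i B)) x))).
  exact: (integrableB measurableT (iw (lhalf i B)) (iw (rhalf i B))).
rewrite -[RHS]fineK; last exact: integrable_fin_num.
congr EFin; rewrite -/(Rintegral mu setT (fun x => w x * psi x)).
transitivity (\int[mu]_x (h^-1 * \sum_(B <- part L s) c B *
    (w x * \1_(cell (lhalf i B)) x - w x * \1_(cell (rhalf i B)) x))).
  rewrite RintegralZl//; last exact: integrable_Rsum.
  congr (_ * _); rewrite Rintegral_sum//; apply: eq_bigr => B _.
  rewrite RintegralZl//; last exact: (integrableB measurableT (iw _) (iw _)).
  by rewrite RintegralB// /cint -!Rintegral_indic.
apply: eq_Rintegral => x _; rewrite /psi mulrCA; congr (_ * _); rewrite mulr_sumr.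
by apply: eq_bigr => B _; ring.
Qed.

End test_functions.

(** The coefficients [c] are the signs of the differences, which turns the pairing into a sum of
    absolute values. *)
Lemma haar_variation L h i s w (V : R) : 0 < L -> 0 < h ->
  (forall B, B \in part L s -> side i B = 2 * h) ->
  mu.-integrable setT (EFin \o w) -> (Var setT w <= V%:E)%E ->
  \sum_(B <- part L s) `|cint w (lhalf i B) - cint w (rhalf i B)| <= h * V.
Proof.
move=> L0 h0 hs wi wV.
have := haar_pairing_le (c := fun B => Num.sg (cint w (lhalf i B) - cint w (rhalf i B)))
  L0 h0 hs _ wi wV.
under eq_bigr do rewrite -normrEsg.
by apply=> B; rewrite normr_sg; case: (_ == 0).
Qed.

End variation_of_averages.

(** * Completeness of L^1 along fast Cauchy sequences *)

Section L1_distance.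
Context d (T : measurableType d) (R : realType).
Variables (mu : {measure set T -> \bar R}) (D : set T).
Hypothesis mD : measurable D.
Implicit Types (f g h : T -> R).

Definition L1dist f g : \bar R := \int[mu]_(x in D) `|f x - g x|%:E.

Let mdist f g : measurable_fun D f -> measurable_fun D g ->
  measurable_fun D (fun x => `|f x - g x|%:E).
Proof.
move=> mf mg; apply/measurable_EFinP.
by apply: measurableT_comp => //; exact: measurable_funB.
Qed.

Lemma L1dist_ge0 f g : (0 <= L1dist f g)%E.
Proof. by apply: integral_ge0 => x _; rewrite lee_fin. Qed.

Lemma L1distC f g : L1dist f g = L1dist g f.
Proof. by apply: eq_integral => x _; rewrite distrC. Qed.

Lemma L1dist_triangle g f h : measurable_fun D f -> measurable_fun D g ->
  measurable_fun D h -> (L1dist f h <= L1dist f g + L1dist g h)%E.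
Proof.
move=> mf mg mh; rewrite /L1dist -ge0_integralD//; try exact: mdist.
  apply: ge0_le_integral => //; first exact: mdist.
  by apply: emeasurable_funD; exact: mdist.
by move=> x _; rewrite -EFinD lee_fin; exact: ler_distD.
Qed.

(** The terms telescope; [maxn n m] makes the bound 0 when the range of summation is empty. *)
Lemma geometric_partial_sum (C : R) n m :
  \sum_(n <= k < m) C / 2 ^+ k <= 2 * C / 2 ^+ n - 2 * C / 2 ^+ maxn n m.
Proof.
have [nm|mn] := leqP n m; last first.
  by rewrite big_geq ?subrr// ltnW.
rewrite (eq_bigr (fun k => 2 * C / 2 ^+ k - 2 * C / 2 ^+ k.+1)).
  by rewrite -[leLHS]opprK -sumrN (eq_bigr (fun k => 2 * C / 2 ^+ k.+1 - 2 * C / 2 ^+ k))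
    ?telescope_sumr ?opprB// => k _; rewrite opprB.
by move=> k _; rewrite exprS invfM; lra.
Qed.

(** Riesz-Fischer: [H], the sum of the absolute increments, is integrable, hence finite almost
    everywhere, and [|g 0| + H] dominates the whole sequence. The factor 2 is that of the geometric
    tail. *)
Lemma L1_fast_cauchy_cvg (g : nat -> T -> R) (C : R) : 0 <= C ->
  (forall n, mu.-integrable D (EFin \o g n)) ->
  (forall n, (L1dist (g n) (g n.+1) <= (C / 2 ^+ n)%:E)%E) ->
  exists2 gl, mu.-integrable D (EFin \o gl) &
    forall n, (L1dist (g n) gl <= (2 * C / 2 ^+ n)%:E)%E.
Proof.
move=> C0 gi gC.
have mg n : measurable_fun D (g n).
  by apply/measurable_EFinP; exact: measurable_int (gi n).
have gnm n m : (L1dist (g n) (g (n + m)%N) <= (\sum_(n <= k < n + m) C / 2 ^+ k)%:E)%E.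
  elim: m => [|m IH].
    rewrite addn0 big_geq// /L1dist; under eq_integral do rewrite subrr normr0.
    by rewrite integral0.
  rewrite addnS big_nat_recr ?leq_addr//= EFinD.
  exact: le_trans (L1dist_triangle (mg _) (mg (n + m)%N) (mg _)) (leeD IH (gC _)).
have gnm' n m : (L1dist (g n) (g (n + m)%N) <= (2 * C / 2 ^+ n)%:E)%E.
  apply: le_trans (gnm n m) _; rewrite lee_fin.
  by apply: le_trans (geometric_partial_sum _ _ _) _; rewrite gerBl divr_ge0 ?mulr_ge0 ?exprn_ge0.
pose H x := (\sum_(0 <= k <oo) `|g k x - g k.+1 x|%:E)%E.
have H0 x : (0 <= H x)%E by apply: nneseries_ge0 => k _ _; rewrite lee_fin.
have mH : measurable_fun D H.
  by apply: ge0_emeasurable_sum => [k x _ _|k _]; [rewrite lee_fin|exact: mdist].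
have Hi : mu.-integrable D H.
  apply/integrableP; split=> //; under eq_integral do rewrite gee0_abs//.
  rewrite integral_nneseries//; last by move=> n; exact: mdist.
  apply: (@le_lt_trans _ _ (2 * C)%:E); last exact: ltry.
  apply: lime_le; first by apply: is_cvg_nneseries => n _ _; exact: L1dist_ge0.
  apply: nearW => n; apply: (@le_trans _ _ (\sum_(0 <= k < n) (C / 2 ^+ k)%:E)%E).
    by apply: lee_sum => k _; exact: gC.
  rewrite sumEFin lee_fin; apply: le_trans (geometric_partial_sum _ _ _) _.
  by rewrite expr0 divr1 gerBl divr_ge0 ?mulr_ge0 ?exprn_ge0.
have sum_g x n : g n x = g 0%N x - series (fun k => g k x - g k.+1 x) n.
  rewrite /series/=; elim: n => [|n IH]; first by rewrite big_geq ?subr0.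
  by rewrite big_nat_recr//= opprD addrA -IH opprB subrKC.
have partial_H x n : ((series (fun k => `|g k x - g k.+1 x|) n)%:E <= H x)%E.
  rewrite /series/= -sumEFin; apply: nneseries_lim_ge => k _ _.
  by rewrite lee_fin.
have cvg_g x : H x \is a fin_num -> cvgn (g^~ x).
  move=> Hx; rewrite (_ : g^~ x = (fun n => g 0%N x - series (fun k => g k x - g k.+1 x) n)).
    apply: is_cvgB; first exact: is_cvg_cst.
    apply: normed_cvg; apply: nondecreasing_is_cvgn.
      by apply: nondecreasing_series => k _ _; exact: normr_ge0.
    exists (fine (H x)) => _ [n _ <-].
    by rewrite -lee_fin fineK//; exact: partial_H.
  by apply/funext => n; exact: sum_g.
(* The upper limit is measurable everywhere and is the limit wherever [H] is finite. *)
pose gl x := fine (limn_esup (fun n => (g n x)%:E)).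
have mgl : measurable_fun D gl.
  apply: (@measurableT_comp _ _ _ _ _ _ fine); first exact: fine_measurable.
  by apply: measurable_fun_limn_esup => n; exact/measurable_EFinP.
have g_gl x : H x \is a fin_num -> (g n x)%:E @[n --> \oo] --> (gl x)%:E.
  move=> /cvg_g /cvg_ex[l gxl].
  have gxlE : (g n x)%:E @[n --> \oo] --> l%:E by apply: cvg_EFin => //; exact: nearW.
  by rewrite /gl (cvg_limn_einf_sup gxlE).2.
have aeH : {ae mu, forall x, D x -> H x \is a fin_num} by exact: integrable_ae.
have [] := @dominated_convergence _ _ _ mu D mD (fun n x => (g n x)%:E)
  (fun x => (gl x)%:E) (fun x => `|(g 0%N x)%:E| + H x)%E.
- by move=> n; exact/measurable_EFinP.
- exact/measurable_EFinP.
- by apply: filterS aeH => x Hx Dx; apply: g_gl; exact: Hx.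
- by apply: integrableD => //; exact: integrable_abse (gi 0%N).
- apply: aeW => x n _.
  apply: (@le_trans _ _ (`|g 0%N x|%:E + (series (fun k => `|g k x - g k.+1 x|) n)%:E)%E).
    rewrite -EFinD lee_fin [X in `|X|]sum_g; apply: le_trans (ler_normB _ _) _.
    by rewrite lerD2l; exact: ler_norm_sum.
  by rewrite leeD2l.
move=> gli cvg_dist _; exists gl => // n.
have L1cvg : L1dist (g m) gl @[m --> \oo] --> 0%E.
  by move: cvg_dist; congr (_ --> _).
have Ccvg : ((2 * C / 2 ^+ n)%:E + L1dist (g m) gl)%E @[m --> \oo] -->
    ((2 * C / 2 ^+ n)%:E + 0)%E.
  by apply: cvgeD => //; exact: cvg_cst.
rewrite -[leRHS]adde0 -(cvg_lim _ Ccvg)//; apply: lime_ge.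
  by apply/cvg_ex; eexists; exact: Ccvg.
exists n => // m /= nm; apply: le_trans (L1dist_triangle (mg n) (mg m) mgl) _.
by rewrite leeD2r// -(subnKC nm); exact: gnm'.
Qed.

End L1_distance.

Section L1_distance_subset.
Context d (T : measurableType d) (R : realType).
Variables (mu : {measure set T -> \bar R}) (A D : set T) (f g : T -> R).
Hypotheses (mA : measurable A) (mD : measurable D) (AD : A `<=` D).

Lemma L1dist_subset : measurable_fun D f -> measurable_fun D g ->
  (L1dist mu A f g <= L1dist mu D f g)%E.
Proof.
move=> mf mg; apply: ge0_subset_integral => //.
apply/measurable_EFinP.
by apply: measurableT_comp => //; exact: measurable_funB.
Qed.

Lemma dist_Rintegral_le : mu.-integrable D (EFin \o f) ->
  mu.-integrable D (EFin \o g) ->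
  (`|\int[mu]_(x in A) f x - \int[mu]_(x in A) g x|%:E <= L1dist mu D f g)%E.
Proof.
move=> fi gi; have fA := integrableS mD mA AD fi; have gA := integrableS mD mA AD gi.
have fgA : mu.-integrable A (EFin \o (fun x => f x - g x)).
  exact: (integrableB mA fA gA).
rewrite -RintegralB// EFin_normr_Rintegral//.
apply: le_trans (le_abse_integral mu mA (measurable_int _ fgA)) _.
by apply: L1dist_subset; apply/measurable_EFinP;
  [exact: measurable_int fi|exact: measurable_int gi].
Qed.

End L1_distance_subset.

(** * L^1 approximation by averages over dyadic boxes *)

Section dyadic_approximation.
Context {R : realType} {N : nat}.
Local Notation E := 'rV[R]_N.
Local Notation mu := (lebesgue N : {measure set E -> \bar R}).
Implicit Types (B : E * E) (w : E -> R) (i l : 'I_N) (s t : seq 'I_N) (x : E).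

(** Each round cuts once in every direction, so the boxes of [grid n] are cubes of side
    [2 * L / 2 ^+ n]. *)
Definition rounds (n : nat) : seq 'I_N := flatten (nseq n (enum 'I_N)).

Lemma count_rounds n i : count_mem i (rounds n) = n.
Proof.
elim: n => [|n IH] //=; rewrite /rounds/= count_cat -/(rounds n) IH.
by rewrite count_uniq_mem ?enum_uniq// mem_enum.
Qed.

Lemma rounds_cat n m : (n <= m)%N -> rounds m = rounds (m - n) ++ rounds n.
Proof. by move=> nm; rewrite /rounds -flatten_cat -nseqD subnK. Qed.

Variable L : R.
Hypothesis L0 : 0 < L.
Local Notation Q := (cell (cube L) : set E).

Definition grid n : seq (E * E) := part L (rounds n).

Lemma side_part_gt0 s l B : B \in part L s -> 0 < side l B.
Proof. by move=> /side_part ->; rewrite divr_gt0 ?mulr_gt0 ?exprn_gt0. Qed.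

Lemma geometric_small (C e : R) : 0 < e ->
  exists m, forall n, (m <= n)%N -> C / 2 ^+ n <= e.
Proof.
move=> e0; exists (Num.bound (`|C| / e)) => n mn.
rewrite ler_pdivrMr ?exprn_gt0// mulrC -ler_pdivrMr//.
apply: (@le_trans _ _ (`|C| / e)); first by rewrite ler_pM2r ?invr_gt0 ?ler_norm.
apply: (@le_trans _ _ (Num.bound (`|C| / e))%:R).
  by apply/ltW/archi_boundP; rewrite divr_ge0// ltW.
apply: (@le_trans _ _ n%:R); first by rewrite ler_nat.
by rewrite -natrX ler_nat ltnW// ltn_expl.
Qed.

Lemma open_grid (U : set E) x : open U -> U x -> Q x ->
  exists n B, [/\ B \in grid n, cell B x & cell B `<=` U].
Proof.
move=> oU Ux Qx; have /nbhs_ballP[e /= e0 xeU] : nbhs x U by exact: open_nbhs_nbhs.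
have [n nP] := geometric_small (2 * L) (divr_gt0 e0 (@ltr0Sn R 1)).
have [B Bn Bx] := cover_part (rounds n) (ltW L0) Qx.
exists n, B; split=> // y By; apply: xeU; split=> // a l; rewrite (ord1 a).
rewrite /ball/= ltr_norml.
have := nP n (leqnn n); have := side_part l Bn; rewrite count_rounds /side => <- ?.
by have /andP[? ?] := Bx l; have /andP[? ?] := By l; apply/andP; split; lra.
Qed.

(** Serves twice: for the measurability of bounded open sets, and to show that the cells generate
    the measurable subsets of the cube. *)
Lemma open_gridE (U : set E) : open U -> U `&` Q =
  \bigcup_n \bigcup_(B in [set` [seq B <- grid n | `[< cell B `<=` U >]]]) cell B.
Proof.
move=> oU; apply/seteqP; split=> [x [Ux Qx]|x [n _ [B]]].
  have [n [B [Bn Bx BU]]] := open_grid oU Ux Qx.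
  by exists n => //; exists B => //=; rewrite mem_filter Bn andbT; apply/asboolP.
rewrite /= mem_filter => /andP[/asboolP BU Bn] Bx; split; first exact: BU.
exact: (part_cell_sub (ltW L0) Bn).
Qed.

Lemma measurable_openI_cube (U : set E) : open U -> measurable (U `&` Q).
Proof.
move=> oU; rewrite open_gridE//; apply: bigcup_measurable => n _.
apply: fin_bigcup_measurable => [|B _]; last exact: measurable_cell.
exact: finite_seq.
Qed.

(** A pi-system on the whole space: only the trace on [Q] is prescribed, so every measurable set
    that misses [Q] belongs to it. The empty trace arises from disjoint cells. *)
Let nested_sets : set (set E) := [set A | measurable A /\
  (A `&` Q = set0 \/ exists n B, B \in grid n /\ A `&` Q = cell B)].

Let nested_setsI : setI_closed nested_sets.
Proof.
move=> A A' [mA AP] [mA' AP']; split; first exact: measurableI.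
rewrite (_ : A `&` A' `&` Q = (A `&` Q) `&` (A' `&` Q)); last first.
  by rewrite setIACA setIid.
case: AP => [->|[n [B [Bn ->]]]]; first by left; rewrite set0I.
case: AP' => [->|[m [B' [Bm ->]]]]; first by left; rewrite setI0.
wlog nm : n m B B' Bn Bm / (n <= m)%N => [hw|].
  have [nm|mn] := leqP n m; first exact: hw nm.
  by rewrite setIC; apply: hw (ltnW mn).
have [] := @part_nested _ _ L (rounds n) (rounds (m - n)) B B' (ltW L0) Bn.
- by rewrite -rounds_cat.
- by move=> BB'; right; exists m, B'; split=> //; exact: setIidr.
- by rewrite setIC; left.
Qed.

Let cell_nested_sets n B : B \in grid n -> nested_sets (cell B).
Proof.
move=> Bn; split; first exact: measurable_cell.
right; exists n, B; split=> //; apply: setIidl.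
exact: (part_cell_sub (ltW L0) Bn).
Qed.

(** Open half-spaces generate. The part of a half-space in [Q] is a countable union of grid cells;
    the part outside [Q] belongs to [nested_sets] outright. *)
Let measurable_nested_sets : measurable `<=` <<s nested_sets >>.
Proof.
apply: smallest_sub; first exact: smallest_sigma_algebra.
move=> A; rewrite -bigcup_seq/= => -[i _ [Y mY <-]].
suff mi : measurable_fun [set: g_sigma_algebraType nested_sets]
    (fun x : E => x ord0 i : R) by exact: mi.
apply: (measurability _ (RGenOInfty.measurableE R)) => //.
move=> _ [_ [a ->] <-]; rewrite setTI.
set U := _ @^-1` _.
have oU : open (U : set E).
  apply: open_comp => [y _|]; first exact: coord_continuous.
  by rewrite set_itv_o_infty; exact: open_gt.
have mU : measurable (U : set E).
  rewrite -[U]setTI; apply: measurable_coord => //.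
rewrite -(setUIDK U Q); apply: measurableU.
  rewrite open_gridE//; apply: bigcup_measurable => n _.
  apply: fin_bigcup_measurable => [|B]; first exact: finite_seq.
  rewrite /= mem_filter => /andP[_ Bn].
  by apply: sub_sigma_algebra; exact: cell_nested_sets Bn.
apply: sub_sigma_algebra; split; first by apply: measurableD => //; exact: measurable_cell.
by left; rewrite setIC setDIK.
Qed.

(* Dynkin's theorem for the pi-system of dyadic boxes. *)
Lemma L1dist_eq0 w v : mu.-integrable setT (EFin \o w) ->
  mu.-integrable setT (EFin \o v) ->
  (forall n B, B \in grid n -> cint w B = cint v B) -> L1dist mu Q w v = 0%E.
Proof.
move=> wi vi wv; have mQ : measurable Q by exact: measurable_cell.
have wS A : measurable A -> mu.-integrable A (EFin \o w).
  by move=> mA; exact: integrableS wi.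
have vS A : measurable A -> mu.-integrable A (EFin \o v).
  by move=> mA; exact: integrableS vi.
pose F := ((fun x => (w x - v x)%:E) \_ Q)%E.
have Fi : mu.-integrable setT F.
  apply/(integrable_mkcond _ mQ).
  exact: (integrableB mQ (wS _ mQ) (vS _ mQ)).
have FE A : measurable A -> (\int[mu]_(x in A) F x =
    (\int[mu]_(x in A `&` Q) w x - \int[mu]_(x in A `&` Q) v x)%:E)%E.
  move=> mA; have mAQ : measurable (A `&` Q) by exact: measurableI.
  rewrite -integral_mkcondr -RintegralB//; [|exact: wS|exact: vS].
  rewrite fineK//; apply: integrable_fin_num => //.
  exact: (integrableB mAQ (wS _ mAQ) (vS _ mAQ)).
pose H := [set A : set E | measurable A /\ (\int[mu]_(x in A) F x = 0)%E].
have nestedH : nested_sets `<=` H.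
  move=> A [mA AP]; split=> //; rewrite FE//.
  case: AP => [->|[n [B [Bn ->]]]]; first by rewrite !Rintegral_set0 subrr.
  by rewrite -/(cint w B) (wv _ _ Bn) subrr.
(* The trace of the whole space on [Q] is the only cell of [grid 0]. The vanishing of the total
   integral then gives stability under complements. *)
have HT : H setT.
  apply: nestedH; split=> //; right; exists 0%N, (cube L).
  by rewrite /grid/= inE eqxx setTI.
have dH : dynkin H.
  split=> // [A [mA A0]|A tA AH].
    split; first exact: measurableC.
    have := @integral_setU _ _ _ mu A (~` A) F mA (measurableC mA).
    rewrite setUv HT.2 A0 add0e => <- //; first exact: measurable_int Fi.
    by apply/disj_setPS; rewrite setICr.
  have mA n : measurable (A n) by have [] := AH n.
  split; first exact: bigcup_measurable.
  rewrite integral_bigcup//; first by apply: eseries0 => n _ _; have [] := AH n.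
  by apply: integrableS Fi => //; exact: bigcup_measurable.
have mH : measurable `<=` H.
  apply: subset_trans measurable_nested_sets _.
  rewrite -(setI_closed_g_dynkin_g_sigma_algebra nested_setsI).
  exact: smallest_sub.
have wvae : ae_eq mu Q (EFin \o w) (EFin \o v).
  apply: integral_ae_eq => //; [exact: wS|exact: measurable_int (vS _ mQ)|].
  move=> A AQ mA; have [_] := mH _ mA; rewrite FE// (setIidl AQ) => -[] /eqP.
  rewrite subr_eq0 => /eqP wvA.
  by rewrite -[LHS]fineK ?(integrable_fin_num _ (wS _ mA))// -[RHS]fineK
    ?(integrable_fin_num _ (vS _ mA))//; congr EFin.
rewrite /L1dist (ae_eq_integral (cst 0%E)) ?integral0//.
- apply/measurable_EFinP; apply: measurableT_comp => //; apply: measurable_funB;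
    apply/measurable_EFinP; [exact: measurable_int (wS _ mQ)|exact: measurable_int (vS _ mQ)].
- by apply: filterS wvae => x wvx Qx; have [->] := wvx Qx; rewrite subrr normr0.
Qed.

Let mu_cell B : (forall l, 0 <= side l B) -> mu (cell B) = (\prod_l side l B)%:E.
Proof. exact: lebesgue_cell. Qed.

Lemma integrable_cell B : mu.-integrable setT (EFin \o \1_(cell B)).
Proof.
have [B0|nB0] := pselect (forall l, 0 <= side l B); last first.
  rewrite (_ : cell B = set0); first by rewrite indic0; exact: integrable0.
  apply/seteqP; split=> // x xB; apply: nB0 => l.
  by rewrite /side subr_ge0; have /andP[/ltW xa] := xB l; exact: le_trans.
apply/integrableP; split.
  by apply/measurable_EFinP; apply: measurable_indic; exact: measurable_cell.
under eq_integral do rewrite /= ger0_norm//.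
rewrite integral_indic//; last exact: measurable_cell.
by rewrite setIT mu_cell// ltry.
Qed.

Lemma integral_cell B : (forall l, 0 <= side l B) ->
  (\int[mu]_x (\1_(cell B) x)%:E = (\prod_l side l B)%:E)%E.
Proof.
move=> B0; rewrite integral_indic//; last exact: measurable_cell.
by rewrite setIT mu_cell.
Qed.

(** On a partition of the cube this is the conditional expectation of [w], extended by 0. *)
Definition averages w (P : seq (E * E)) x : R :=
  \sum_(B <- P) cint w B / (\prod_l side l B) * \1_(cell B) x.

Let integrable_scaled_cell (c : R) B :
  mu.-integrable setT (EFin \o (fun x => c * \1_(cell B) x)).
Proof. exact: (integrableZl measurableT c (integrable_cell B)). Qed.

Lemma integrable_averages w P : mu.-integrable setT (EFin \o averages w P).
Proof. by apply: integrable_Rsum => // B; exact: integrable_scaled_cell. Qed.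

(** Division by the volumes makes each term of the majorant integrate to [c B]. *)
Lemma L1dist_le_step s (c : E * E -> R) (f g : E -> R) :
  measurable_fun setT f -> measurable_fun setT g ->
  (forall x, `|f x - g x| <=
    \sum_(B <- part L s) c B / (\prod_l side l B) * \1_(cell B) x) ->
  (L1dist mu setT f g <= (\sum_(B <- part L s) c B)%:E)%E.
Proof.
move=> mf mg fg; have ic B := integrable_scaled_cell (c B / \prod_l side l B) B.
apply: (@le_trans _ _ (\int[mu]_x
    (\sum_(B <- part L s) c B / (\prod_l side l B) * \1_(cell B) x)%:E)%E).
  apply: ge0_le_integral => //.
  - by apply/measurable_EFinP; apply: measurableT_comp => //; exact: measurable_funB.
  - by apply: (measurable_int mu); exact: integrable_Rsum.
  - by move=> x _; rewrite lee_fin.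
rewrite -[leLHS]fineK; last by apply: integrable_fin_num => //; exact: integrable_Rsum.
rewrite lee_fin -/(Rintegral _ _ _) Rintegral_sum//.
rewrite big_seq [leRHS]big_seq; apply: ler_sum => B Bs.
have v0 : 0 < \prod_l side l B by apply: prodr_gt0 => l _; exact: side_part_gt0 Bs.
rewrite RintegralZl//; last exact: integrable_cell.
rewrite /Rintegral integral_cell/=; last by move=> l; apply/ltW/(side_part_gt0 l Bs).
by rewrite divfK ?gt_eqF.
Qed.

Lemma measurable_averages w P : measurable_fun setT (averages w P).
Proof. by apply/measurable_EFinP; exact: measurable_int (integrable_averages w P). Qed.

Lemma L1dist_averages2 w v s :
  (L1dist mu setT (averages w (part L s)) (averages v (part L s)) <=
   (\sum_(B <- part L s) `|cint w B - cint v B|)%:E)%E.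
Proof.
apply: L1dist_le_step; [exact: measurable_averages|exact: measurable_averages|].
move=> x; rewrite /averages -sumrB; apply: le_trans (ler_norm_sum _ _ _) _.
rewrite big_seq [leRHS]big_seq; apply: ler_sum => B Bs.
have v0 : 0 < \prod_l side l B by apply: prodr_gt0 => l _; exact: side_part_gt0 Bs.
rewrite -mulrBl -mulrBl !normrM normfV (gtr0_norm v0) ler_wpM2l ?divr_ge0 ?(ltW v0)//.
by rewrite ger0_norm.
Qed.

Section averages_of_integrable.
Variable w : E -> R.
Hypothesis wi : mu.-integrable setT (EFin \o w).

Let iw B : mu.-integrable setT (EFin \o (fun x => w x * \1_(cell B) x)).
Proof. by apply: integrable_indicMr => //; exact: measurable_cell. Qed.

Lemma cint_half i B : (forall l, 0 <= side l B) ->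
  cint w B = cint w (lhalf i B) + cint w (rhalf i B).
Proof.
move=> B0; have cE C : cint w C = \int[mu]_x (w x * \1_(cell C) x) by exact: Rintegral_indic.
rewrite !cE -(RintegralD measurableT (iw _) (iw _)).
by apply: eq_Rintegral => x _; rewrite -mulrDr cell_half.
Qed.

(** Tower property: a cell of the finer partition lies in [B], and then averaging keeps its
    integral, or it misses [B]. *)
Lemma cint_averages s t B : B \in part L s ->
  cint (averages w (part L (t ++ s))) B = cint w B.
Proof.
move=> Bs; rewrite /cint [LHS]Rintegral_indic [RHS]Rintegral_indic.
under eq_Rintegral do rewrite mulr_suml.
rewrite Rintegral_sum//; last first.
  by move=> C; exact: (integrable_indicMr (measurable_cell B) (integrable_scaled_cell _ C)).
transitivity (\sum_(C <- part L (t ++ s)) \int[mu]_x (w x * \1_(cell C) x * \1_(cell B) x)).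
  rewrite big_seq [RHS]big_seq; apply: eq_bigr => C Cts.
  have [CB|CB] := part_nested (ltW L0) Bs Cts; last first.
    have CB0 x : \1_(cell C) x * \1_(cell B) x = 0 :> R.
      by rewrite -[LHS]/((\1_(cell C) \* \1_(cell B)) x) -indicI CB indic0.
    by under eq_Rintegral do rewrite -mulrA CB0 mulr0;
      under [RHS]eq_Rintegral do rewrite -mulrA CB0 mulr0.
  have CBE x : \1_(cell C) x * \1_(cell B) x = \1_(cell C) x :> R.
    by rewrite -[LHS]/((\1_(cell C) \* \1_(cell B)) x) -indicI (setIidl CB).
  under eq_Rintegral do rewrite -mulrA CBE.
  under [RHS]eq_Rintegral do rewrite -mulrA CBE.
  rewrite RintegralZl//; last exact: integrable_cell.
  rewrite /Rintegral integral_cell/=; last by move=> l; apply/ltW/(side_part_gt0 l Cts).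
  rewrite divfK ?gt_eqF//; last by apply: prodr_gt0 => l _; exact: side_part_gt0 Cts.
  by rewrite /cint Rintegral_indic.
rewrite -Rintegral_sum//; last by move=> C; exact: (integrable_indicMr (measurable_cell B) (iw C)).
apply: eq_Rintegral => x _; rewrite -mulr_suml -mulr_sumr (cell_part _ _ (ltW L0)).
have BQ := part_cell_sub (ltW L0) Bs.
have [xB|xB] := boolP (x \in cell B).
  have xQ : x \in cell (cube L) by rewrite inE in xB; rewrite inE; exact: BQ.
  by rewrite !indicE xQ mulr1.
by rewrite !indicE (negbTE xB) !mulr0.
Qed.

(** A half has volume [v / 2], so its average differs from that of the box by plus or minus
    [dB B / v]: the change is a multiple of a Haar function, of constant modulus on the box. *)
Lemma L1dist_refine i s : (L1dist mu setT (averages w (part L s))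
    (averages w (part L (i :: s))) <=
  (\sum_(B <- part L s) `|cint w (lhalf i B) - cint w (rhalf i B)|)%:E)%E.
Proof.
pose dB B := cint w (lhalf i B) - cint w (rhalf i B).
apply: L1dist_le_step; [exact: measurable_averages|exact: measurable_averages|].
move=> x; rewrite /averages big_refine -sumrB; apply: le_trans (ler_norm_sum _ _ _) _.
rewrite big_seq [leRHS]big_seq; apply: ler_sum => B Bs.
set v := \prod_l side l B.
have B0 l : 0 <= side l B by apply/ltW/(side_part_gt0 l Bs).
have v0 : 0 < v by apply: prodr_gt0 => l _; exact: side_part_gt0 Bs.
have vh C : C = lhalf i B \/ C = rhalf i B -> \prod_l side l C = v / 2.
  move=> CB; rewrite /v (bigD1 i)//= [in RHS](bigD1 i)//= mulrAC; congr (_ * _).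
    by have [hl hr] := side_half i i B; rewrite eqxx in hl hr; case: CB => ->.
  apply: eq_bigr => l li; have [hl hr] := side_half i l B.
  by rewrite (negbTE li) in hl hr; case: CB => ->.
rewrite (vh (lhalf i B)); last by left.
rewrite (vh (rhalf i B)); last by right.
rewrite -(cell_half i x B0) (cint_half i B0).
rewrite (_ : _ - _ = - (dB B / v * (\1_(cell (lhalf i B)) x - \1_(cell (rhalf i B)) x))).
  rewrite normrN !normrM normfV (gtr0_norm v0).
  rewrite ler_wpM2l ?divr_ge0 ?(ltW v0)//; apply: le_trans (ler_normB _ _) _.
  by rewrite !ger0_norm.
by rewrite /dB; field; rewrite gt_eqF.
Qed.

Variable V : R.
Hypotheses (V0 : 0 <= V) (wV : (Var setT w <= V%:E)%E).

(** By [haar_variation] a cut costs at most half the current side times [V]; after [n] rounds that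
    half side is at most [L / 2 ^+ n] in every direction. *)
Lemma L1dist_rounds n t : (L1dist mu setT (averages w (grid n))
    (averages w (part L (t ++ rounds n))) <= ((size t)%:R * (L * V / 2 ^+ n))%:E)%E.
Proof.
elim: t => [|i t IH].
  rewrite mul0r /L1dist; under eq_integral do rewrite subrr normr0.
  by rewrite integral0.
apply: le_trans (L1dist_triangle _ measurableT (measurable_averages _ _)
  (measurable_averages w (part L (t ++ rounds n))) (measurable_averages _ _)) _.
rewrite [in leRHS]/= -natr1 mulrDl mul1r EFinD; apply: leeD => //.
apply: le_trans (L1dist_refine i (t ++ rounds n)) _; rewrite lee_fin.
set k := count_mem i (t ++ rounds n).
have nk : (n <= k)%N by rewrite /k count_cat count_rounds leq_addl.
apply: (@le_trans _ _ (L / 2 ^+ k * V)).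
  apply: haar_variation => //; first by rewrite divr_gt0 ?exprn_gt0.
  by move=> B /side_part ->; rewrite mulrA.
rewrite mulrAC ler_wpM2l ?mulr_ge0 ?(ltW L0)// lef_pV2 ?posrE ?exprn_gt0//.
by rewrite ler_eXn2l// ltr1n.
Qed.

(** A round is [N] cuts, so it costs at most [N * L * V / 2 ^+ n]; the factor 2 sums the later
    rounds. *)
Lemma L1dist_averages n : (L1dist mu Q (averages w (grid n)) w <=
  (2 * (N%:R * L * V) / 2 ^+ n)%:E)%E.
Proof.
have C0 : 0 <= N%:R * L * V by rewrite !mulr_ge0// ltW.
have gi k : mu.-integrable setT (EFin \o averages w (grid k)) by exact: integrable_averages.
have [|v vi gv] := L1_fast_cauchy_cvg measurableT C0 gi.
  move=> k; have := L1dist_rounds k (enum 'I_N).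
  by rewrite size_enum_ord !mulrA.
have mQ : measurable Q by exact: measurable_cell.
have mf f : mu.-integrable setT (EFin \o f) -> measurable_fun Q f.
  move=> fi; apply/measurable_EFinP; apply: (measurable_int mu).
  exact: integrableS fi.
apply: le_trans (L1dist_triangle _ mQ (mf _ (gi n)) (mf _ vi) (mf _ wi)) _.
rewrite [X in (_ + X)%E](_ : _ = 0%E) ?adde0; last first.
  (* Averages over grids finer than [grid k] have the same integral over [B] as [w], and they tend
     to [v] in L^1. *)
  apply: L1dist_eq0 => // k B Bk; apply/eqP; rewrite -subr_eq0 -normr_le0.
  apply/ler_addgt0Pr => e e0; rewrite add0r.
  have [m mP] := geometric_small (2 * (N%:R * L * V)) e0.
  apply: le_trans (mP (maxn m k) (leq_maxl _ _)); rewrite -lee_fin.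
  apply: le_trans (gv (maxn m k)).
  rewrite -(cint_averages (rounds (maxn m k - k)) Bk) -rounds_cat ?leq_maxr//.
  rewrite distrC; apply: (dist_Rintegral_le (measurable_cell B) measurableT) => //; exact: gi.
apply: le_trans (gv n).
by apply: L1dist_subset => //; apply/measurable_EFinP;
  [exact: (measurable_int mu (gi n))|exact: (measurable_int mu vi)].
Qed.

End averages_of_integrable.

End dyadic_approximation.

(** * From L^p to L^1 on sets of finite measure *)

Section L1_versus_Lp.
Context {R : realType} {N : nat}.
Local Notation E := 'rV[R]_N.
Local Notation mu := (lebesgue N : {measure set E -> \bar R}).
Implicit Types (U : set E) (f g : E -> R) (p : \bar R) (e : R).

Lemma LpNorm1E U f : LpNorm U 1 f = (\int[mu]_(x in U) `|f x|%:E)%E.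
Proof.
rewrite /LpNorm Lnorm1 [RHS]integral_mkcond; apply: eq_integral => x _.
by rewrite !patchE; case: ifP => // _; rewrite abse0.
Qed.

Lemma LpNorm1B U f g : LpNorm U 1 (f \- g) = L1dist mu U f g.
Proof. exact: LpNorm1E. Qed.

Lemma Lp1_integrable U f : Lp U 1 f <-> mu.-integrable U (EFin \o f).
Proof.
rewrite /Lp LpNorm1E; split=> [[mf fU]|fi].
  by apply/integrableP; split=> //; exact/measurable_EFinP.
by have /integrableP[/measurable_EFinP mf fU] := fi.
Qed.

(** For [t > e] the factor (t / e)^(r - 1) is at least 1. Both terms are of the order of [e] once
    integrated at [t = |f|]: if the L^r norm of [f] is at most [e], the second gives at most [e]. *)
Lemma le_powR_split e (r t : R) : 0 < e -> 1 <= r -> 0 <= t ->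
  t <= e + e `^ (1 - r) * t `^ r.
Proof.
move=> e0 r1 t0; have [te|et] := leP t e.
  by rewrite (le_trans te)// lerDl mulr_ge0 ?powR_ge0.
have tpos : 0 < t by exact: lt_trans et.
apply: (@le_trans _ _ (e `^ (1 - r) * t `^ r)); last by rewrite lerDr ltW.
have -> : t `^ r = t `^ (r - 1) * t.
  by rewrite -{3}(powRr1 t0) -powRD ?subrK// (gt_eqF tpos) implybT.
rewrite mulrA ler_peMl//.
apply: (@le_trans _ _ (e `^ (1 - r) * e `^ (r - 1))).
  rewrite -powRD; first by rewrite addrC subrKA subrr powRr0.
  by rewrite (gt_eqF e0) implybT.
by rewrite ler_wpM2l ?powR_ge0// ge0_ler_powR ?subr_ge0 ?nnegrE// ltW.
Qed.

(* Integrating le_powR_split avoids the conjugate exponent in Hoelder's inequality. *)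
Lemma L1_le_of_Lp U f p e : measurable U -> (mu U < +oo)%E ->
  measurable_fun U f -> (1 <= p)%E -> 0 < e -> (LpNorm U p f <= e%:E)%E ->
  (\int[mu]_(x in U) `|f x|%:E <= (e * (fine (mu U) + 1))%:E)%E.
Proof.
move=> mU Uoo mf p1 e0 fe.
have muUE : mu U = (fine (mu U))%:E by rewrite fineK// ge0_fin_numE.
have mnf : measurable_fun U (fun x => `|f x|%:E).
  by apply/measurable_EFinP; apply: measurableT_comp.
have ecst : (\int[mu]_(x in U) e%:E <= (e * (fine (mu U) + 1))%:E)%E.
  rewrite integral_cst// [in leLHS]muUE -EFinM lee_fin.
  by rewrite ler_pM2l// lerDl.
case: p p1 fe => [r|_|//]; last first.
  rewrite /LpNorm unlock; case: ifPn => [_ /ess_supP fe|].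
    apply: le_trans ecst; apply: ae_ge0_le_integral => //.
      by move=> x _; rewrite lee_fin ltW.
    apply: filterS fe => x /= + Ux; rewrite patchE mem_set//=.
  (* Here the whole space is null, the L^oo norm is 0 by convention and carries no information on
     [f]; but then [U] is null as well. *)
  rewrite -leNgt => muT _.
  have U0 : mu U = 0%E.
    by apply/eqP; rewrite -measure_le0; apply: le_trans muT; apply: le_measure; rewrite ?inE.
  by rewrite null_set_integral// lee_fin mulr_ge0 ?addr_ge0 ?fine_ge0// ltW.
rewrite lee_fin => r1 fe; have r0 : 0 < r by exact: lt_le_trans r1.
have fr : (\int[mu]_(x in U) (`|f x| `^ r)%:E <= (e `^ r)%:E)%E.
  have : (LpNorm U r%:E f `^ r <= e%:E `^ r)%E.
    apply: gt0_ler_poweR => //; first exact: ltW.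
      by rewrite in_itv/= leey andbT Lnorm_ge0.
    by rewrite in_itv/= leey andbT lee_fin ltW.
  rewrite poweR_Lnorm ?gt_eqF//= => fr; apply: le_trans fr.
  rewrite integral_mkcond le_eqVlt; apply/orP; left; apply/eqP.
  apply: eq_integral => x _; rewrite !patchE; case: ifP => _ //.
  by rewrite abse0 poweR0r// gt_eqF.
have mfr : measurable_fun U (fun x => (`|f x| `^ r)%:E).
  apply/measurable_EFinP; apply: (measurableT_comp (measurable_powR r)).
  exact: measurableT_comp.
apply: (@le_trans _ _ (\int[mu]_(x in U)
    (e%:E + (e `^ (1 - r))%:E * (`|f x| `^ r)%:E))%E).
  apply: ge0_le_integral => //.
    by apply: emeasurable_funD => //; exact: measurable_funeM.
  by move=> x _; rewrite -EFinM -EFinD lee_fin; exact: le_powR_split.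
rewrite ge0_integralD//; last 3 first.
- by move=> x _; rewrite lee_fin ltW.
- by move=> x _; rewrite -EFinM lee_fin mulr_ge0 ?powR_ge0.
- exact: measurable_funeM.
rewrite ge0_integralZl//; last by rewrite lee_fin powR_ge0.
rewrite integral_cst// [in leLHS]muUE mulrDr mulr1 EFinD EFinM; apply: leeD => //.
apply: (@le_trans _ _ ((e `^ (1 - r))%:E * (e `^ r)%:E)%E).
  by apply: lee_wpmul2l => //; rewrite lee_fin powR_ge0.
rewrite -EFinM lee_fin -powRD ?subrK ?powRr1 ?(ltW e0)//.
by rewrite (gt_eqF e0) implybT.
Qed.

End L1_versus_Lp.

(** * Limits along an ultrafilter and extraction of a subsequence *)

Section ultrafilter_subsequences.
Context {R : realType} (F : set_system nat) {UF : UltraFilter F}.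

(** Compactness of the segment gives a cluster point; since an ultrafilter contains a set or its
    complement, it is a limit. *)
Lemma ultra_bounded_cvg (a : nat -> R) (K : R) : (forall n, `|a n| <= K) ->
  exists l, forall e : R, 0 < e -> F [set n | `|a n - l| <= e].
Proof.
move=> aK; have PF : ProperFilter F by exact: ultra_proper.
have aF : (a @ F) `[- K, K]%classic.
  rewrite /fmap/=; by apply: filterE => n /=; rewrite in_itv/= -ler_norml.
have [l [_ al]] := segment_compact (fmap_proper_filter a _) aF.
exists l => e e0; have [//|Fe] := in_ultra_setVsetC [set n | `|a n - l| <= e] UF.
have [y [/= ye]] := al [set y | ~ `|y - l| <= e] _ Fe (nbhsx_ballx l e e0).
by rewrite /ball/= distrC => /ltW.
Qed.

Lemma filter_all_seq (T : eqType) (s : seq T) (P : T -> set nat) :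
  (forall B, B \in s -> F (P B)) -> F [set n | forall B, B \in s -> P B n].
Proof.
have PF : ProperFilter F by exact: ultra_proper.
elim: s => [_|B s IH sP]; first by apply: filterE => n B; rewrite in_nil.
apply: filterS2 (sP B (mem_head _ _)) (IH _).
  by move=> n PB Ps C; rewrite inE => /orP[/eqP ->//|]; exact: Ps.
by move=> C Cs; apply: sP; rewrite inE Cs orbT.
Qed.

(** The sets for the various [e] all belong to [F], so finitely many of them meet, and at
    arbitrarily large indices because [F] refines [\oo]. *)
Lemma ultra_cauchy_subsequence (d : nat -> nat -> \bar R) : \oo `<=` F ->
  (forall e : R, 0 < e -> exists2 S, F S & forall n m, S n -> S m -> (d n m <= e%:E)%E) ->
  exists2 s : nat -> nat, increasing_seq s &
    forall k, (d (s k) (s k.+1) <= (1 / 2 ^+ k)%:E)%E.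
Proof.
move=> ooF dF; have PF : ProperFilter F by exact: ultra_proper.
have /choice[S SP] k : exists S, F S /\
    forall n m, S n -> S m -> (d n m <= (1 / 2 ^+ k)%:E)%E.
  have [S FS Sd] := dF (1 / 2 ^+ k) (divr_gt0 ltr01 (exprn_gt0 k (ltr0Sn R 1))).
  by exists S.
(* All [S j] with [j <= k] are required because they need not be nested: [s k] and [s k.+1] must
   both lie in [S k]. *)
have next k n : exists m, (n < m)%N /\ forall j, (j <= k)%N -> S j m.
  have FS : F [set m | forall j, j \in iota 0 k.+1 -> S j m].
    by apply: filter_all_seq => j _; have [] := SP j.
  have Fn : F [set m | (n < m)%N] by apply: ooF; exact: nbhs_infty_gt.
  have [m [mS nm]] := filter_ex (filterI FS Fn); exists m; split=> // j jk.
  by apply: mS; rewrite mem_iota.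
pose f k n := projT1 (cid (next k n)).
have fP k n : (n < f k n)%N /\ forall j, (j <= k)%N -> S j (f k n).
  exact: projT2 (cid (next k n)).
pose s := fix s k := if k is k'.+1 then f k (s k') else f 0%N 0%N.
exists s; first by apply/increasing_seqP => k; exact: (fP k.+1 (s k)).1.
move=> k; apply: (SP k).2; last exact: (fP k.+1 (s k)).2.
by case: k => [|k]; [exact: (fP 0%N 0%N).2|exact: (fP k.+1 (s k)).2].
Qed.

End ultrafilter_subsequences.

(** * Bounded sequences in BV of an extension domain *)

Section compactness.
Context {R : realType} {N : nat}.
Local Notation E := 'rV[R]_N.
Local Notation mu := (lebesgue N : {measure set E -> \bar R}).
Implicit Types (U : set E) (f g : E -> R).

Lemma bounded_sub_cube U : bounded_set U ->
  exists2 L : R, 0 < L & U `<=` cell (cube L).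
Proof.
(* Boundedness controls the norm by any number above [M], here [|M| + 1]; one more unit gives the
   strict inequality at the open end of the cell. *)
move=> [M [_ UM]]; exists (`|M| + 2); first by have := normr_ge0 M; lra.
move=> x Ux l; rewrite !mxE.
have xM : `|x| <= `|M| + 1 by apply: UM => //; have := ler_norm M; lra.
have xl : `|x ord0 l| <= `|x|.
  by rewrite /Num.norm/= mx_normrE; apply: (le_bigmax _ (fun ij => `|x ij.1 ij.2|) (ord0, l)).
move: (le_trans xl xM); rewrite ler_norml => /andP[? ?].
by apply/andP; split; lra.
Qed.

Lemma measurable_open_bounded U : open U -> bounded_set U ->
  measurable U /\ (mu U < +oo)%E.
Proof.
move=> oU /bounded_sub_cube[L L0 UL].
have mU : measurable U by rewrite -(setIidl UL); exact: measurable_openI_cube.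
split=> //; apply: (@le_lt_trans _ _ (mu (cell (cube L)))).
  by apply: le_measure; rewrite ?inE//; exact: measurable_cell.
rewrite [X in (X < _)%E]lebesgue_cell ?ltry// => l.
by rewrite /side !mxE opprK addr_ge0// ltW.
Qed.

Section extension_domain.
Variables (U : set E) (oU : open U) (bU : bounded_set U).
Hypothesis extU : BV_extension_domain U.
Variables (F : set_system nat) (UF : UltraFilter F).

(* Extended to R^N, the v n are uniformly close to their averages over small
   dyadic boxes, which range over a bounded set in a finite-dimensional space. *)
Lemma BV_bounded_ultra_cauchy (v : nat -> E -> R) (K e : R) :
  (forall n, BV U (v n)) -> (forall n, (BVnorm U (v n) <= K%:E)%E) -> 0 < e ->
  exists2 S, F S & forall n m, S n -> S m -> (L1dist mu U (v n) (v m) <= e%:E)%E.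
Proof.
move=> vBV vK e0; have [L L0 UL] := bounded_sub_cube bU.
have [mU _] := measurable_open_bounded oU bU.
(* Scalar functions are extended to the whole space, where the smoothed tents are admissible
   although they spill out of the cube. *)
have [_ _ /(_ setT 1%N openT (@subsetT _ _) isT)[T extT]] := extU.
have [C TC] := ext_continuous extT.
pose w n := T (fun=> v n) ord0.
have wBV n : BV setT (w n) by exact: (ext_BV extT).
pose K' : R := `|C| * `|K|.
have wK n : (BVnorm setT (w n) <= K'%:E)%E.
  have := TC (fun=> v n) (fun=> vBV n); rewrite !big_ord1 => /le_trans; apply.
  have v0 : (0 <= BVnorm U (v n))%E.
    by apply: adde_ge0; [exact: Lnorm_ge0|exact: Var_ge0].
  apply: (@le_trans _ _ (`|C|%:E * BVnorm U (v n))%E).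
    by apply: lee_wpmul2r => //; rewrite lee_fin ler_norm.
  rewrite EFinM; apply: lee_wpmul2l; first by rewrite lee_fin.
  by apply: le_trans (vK n) _; rewrite lee_fin ler_norm.
have K'0 : 0 <= K' by rewrite mulr_ge0.
have wi n : mu.-integrable setT (EFin \o w n).
  by apply/Lp1_integrable; have [] := wBV n.
have wV n : (Var setT (w n) <= K'%:E)%E.
  by apply: le_trans (wK n); rewrite leeDr// Lnorm_ge0.
have w1 n : (L1dist mu setT (w n) (cst 0%R) <= K'%:E)%E.
  apply: le_trans (wK n); rewrite /BVnorm LpNorm1E.
  apply: (@le_trans _ _ (\int[mu]_x `|w n x|%:E)%E); last by rewrite leeDl// Var_ge0.
  by rewrite /L1dist; under eq_integral do rewrite subr0.
have e3 : 0 < e / 3 by rewrite divr_gt0.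
(* The level [m] depends on [e] and [K'] only, so one grid serves all [n]. *)
have [m /(_ m (leqnn m)) mP] := geometric_small (2 * (N%:R * L * K')) e3.
pose h n := averages (w n) (grid L m).
have mv n : measurable_fun U (v n) by have [[]] := vBV n.
have mw n : measurable_fun U (w n).
  apply/measurable_EFinP; apply: (measurable_int mu).
  exact: integrableS (wi n).
have mh n : measurable_fun U (h n).
  by apply: measurable_funTS; exact: measurable_averages.
have vh n : (L1dist mu U (v n) (h n) <= (e / 3)%:E)%E.
  have -> : L1dist mu U (v n) (h n) = L1dist mu U (w n) (h n).
    apply: ae_eq_integral => //.
    - by apply/measurable_EFinP; apply: measurableT_comp => //; exact: measurable_funB.
    - by apply/measurable_EFinP; apply: measurableT_comp => //; exact: measurable_funB.
    - have := ext_extends extT (fun=> vBV n) ord0.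
      by apply: filterS => x wv Ux; rewrite -(wv Ux).
  rewrite L1distC; apply: le_trans (_ : (_ <= L1dist mu (cell (cube L)) (h n) (w n))%E) _.
    apply: L1dist_subset => //; first exact: measurable_cell.
      by apply: measurable_funTS; exact: measurable_averages.
    apply/measurable_EFinP; apply: (measurable_int mu).
    by apply: integrableS (wi n) => //; exact: measurable_cell.
  apply: le_trans (L1dist_averages L0 (wi n) K'0 (wV n) m) _.
  by rewrite lee_fin.
have aK B n : `|cint (w n) B| <= K'.
  rewrite -lee_fin; apply: le_trans (w1 n).
  have i0 : mu.-integrable setT (EFin \o cst (0 : R)) by exact: integrable0.
  have := dist_Rintegral_le (measurable_cell B) measurableT (@subsetT _ _) (wi n) i0.
  by rewrite [X in _ - X]Rintegral_cst ?mul0r ?subr0//; exact: measurable_cell.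
have [l lP] := choice (fun B => ultra_bounded_cvg (aK B)).
pose G : seq (E * E) := grid L m.
(* Two integrals close to the same limit differ by at most [2 * del], and [size G] such terms stay
   below [e / 3]; the successor avoids a division by 0. *)
pose del := e / 3 / (2 * (size G).+1%:R).
have del0 : 0 < del by rewrite divr_gt0// mulr_gt0.
exists [set n | forall B, B \in G -> `|cint (w n) B - l B| <= del].
  by apply: filter_all_seq => B _; exact: lP.
move=> n k nS kS.
have hh : (L1dist mu U (h n) (h k) <= (e / 3)%:E)%E.
  apply: le_trans (_ : (_ <= L1dist mu setT (h n) (h k))%E) _.
    by apply: L1dist_subset => //; exact: measurable_averages.
  apply: le_trans (L1dist_averages2 L0 _ _ _) _; rewrite lee_fin.
  apply: (@le_trans _ _ (\sum_(B <- G) (2 * del))).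
    rewrite big_seq [leRHS]big_seq; apply: ler_sum => B Bm.
    apply: le_trans (ler_distD (l B) _ _) _; rewrite mulr2n mulrDl mul1r.
    by apply: lerD; [exact: nS|rewrite distrC; exact: kS].
  have -> : 2 * del = e / 3 / (size G).+1%:R.
    by rewrite /del invfM mulrCA; congr (_ * _); rewrite mulrA mulfV ?mul1r ?pnatr_eq0.
  rewrite big_const_seq count_predT iter_addr_0 -[leLHS]mulr_natr mulrAC.
  by rewrite ler_pdivrMr// ler_wpM2l ?ler_nat// ltW.
apply: le_trans (L1dist_triangle _ mU (mv n) (mh n) (mv k)) _.
apply: le_trans (leeD (vh n) (L1dist_triangle _ mU (mh n) (mh k) (mv k))) _.
apply: le_trans (leeD (lexx _) (leeD hh (_ : (_ <= (e / 3)%:E)%E))) _.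
  by rewrite L1distC; exact: vh.
by rewrite -!EFinD lee_fin; lra.
Qed.

End extension_domain.
End compactness.

Theorem theorem3p12 (R : realType) (N : nat) (Omega : set 'rV[R]_N)
    (p : \bar R) (u : nat -> 'rV[R]_N -> R) :
  (0 < N)%N ->
  open Omega -> bounded_set Omega -> BV_extension_domain Omega ->
  (N = 1%N -> is_interval [set t : R | Omega (const_mx t)]) ->
  (1 <= p)%E ->
  (forall n, regulated Omega p (u n)) ->
  (ereal_sup (range (fun n => LpNorm Omega 1 (u n))) < +oo)%E ->
  (forall e : R, 0 < e ->
    (ereal_sup (range (fun n => eps_Var Omega p e (u n))) < +oo)%E) ->
  exists (s : nat -> nat) (v : 'rV[R]_N -> R),
    [/\ increasing_seq s,
        Lp Omega 1 v &
        LpNorm Omega 1 (u (s k) \- v) @[k --> \oo] --> 0%E].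
Proof.
move=> _ oO bO extO _ p1 ureg u1 uVar.
have [mO Ooo] := measurable_open_bounded oO bO.
have [F [UF ooF]] := ultraFilterLemma eventually_filter.
have mu_u n : measurable_fun Omega (u n) by have [[]] := ureg n.
(* The bound is strict so that an infimum below it is undercut by an actual competitor [v]. *)
have lt_fin (x : \bar R) : (x < +oo)%E -> exists r : R, (x < r%:E)%E.
  case: x => [r _|//|_]; last by exists 0; exact: ltNyr.
  by exists (r + 1); rewrite lte_fin ltrDl.
have [M1 M1P] := lt_fin _ u1.
have u1n n : (LpNorm Omega 1 (u n) <= M1%:E)%E.
  by apply: le_trans (ltW M1P); apply: ereal_sup_ubound; exists n.
pose c := fine (lebesgue N Omega) + 1.
have c0 : 0 < c by rewrite ltr_wpDl// fine_ge0.
have [e e0|s sinc sd] := ultra_cauchy_subsequence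
    (d := fun n m => L1dist (lebesgue N) Omega (u n) (u m)) ooF.
  (* [L1_le_of_Lp] turns L^p distance [e1] into L^1 distance [e1 * c], that is [e / 3]. *)
  pose e1 := e / (3 * c).
  have e10 : 0 < e1 by rewrite divr_gt0// mulr_gt0.
  have [M2 M2P] := lt_fin _ (uVar e1 e10).
  (* These approximants depend on [e]; only the index set [S] obtained from them survives, and it
     speaks of the [u n] alone. *)
  have /choice[v vP] n : exists v, [/\ BV Omega v,
      (L1dist (lebesgue N) Omega (u n) v <= (e / 3)%:E)%E & (Var Omega v <= M2%:E)%E].
    have : (eps_Var Omega p e1 (u n) < M2%:E)%E.
      by apply: le_lt_trans M2P; apply: ereal_sup_ubound; exists n.
    move=> /ereal_inf_lt[_ [v [vBV uv] <-] vM2]; exists v; split=> //; last exact: ltW.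
    have mv : measurable_fun Omega v by have [[]] := vBV.
    have muv : measurable_fun Omega (u n \- v) by exact: measurable_funB.
    apply: le_trans (L1_le_of_Lp mO Ooo muv p1 e10 uv) _.
    rewrite lee_fin -/c /e1 (_ : e / (3 * c) * c = e / 3)//.
    by field; rewrite gt_eqF.
  have vBV n : BV Omega (v n) by have [] := vP n.
  have mv n : measurable_fun Omega (v n) by have [[]] := vBV n.
  have uv n : (L1dist (lebesgue N) Omega (u n) (v n) <= (e / 3)%:E)%E by have [] := vP n.
  have vK n : (BVnorm Omega (v n) <= (e / 3 + M1 + M2)%:E)%E.
    rewrite EFinD; apply: leeD; last by have [] := vP n.
    have m0 : measurable_fun Omega (cst (0 : R)) by exact: measurable_cst.
    have n0 (f : 'rV[R]_N -> R) : LpNorm Omega 1 f = L1dist (lebesgue N) Omega f (cst 0).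
      by rewrite LpNorm1E; apply: eq_integral => x _; rewrite subr0.
    rewrite n0; apply: le_trans (L1dist_triangle _ mO (mv n) (mu_u n) m0) _.
    rewrite EFinD; apply: leeD; first by rewrite L1distC.
    by rewrite -n0.
  have e3 : 0 < e / 3 by rewrite divr_gt0.
  have [S FS SP] := BV_bounded_ultra_cauchy oO bO extO UF vBV vK e3.
  exists S => // n m Sn Sm.
  apply: le_trans (L1dist_triangle _ mO (mu_u n) (mv n) (mu_u m)) _.
  apply: le_trans (leeD (uv n) (L1dist_triangle _ mO (mv n) (mv m) (mu_u m))) _.
  apply: le_trans (leeD (lexx _) (leeD (SP n m Sn Sm) (_ : (_ <= (e / 3)%:E)%E))) _.
    by rewrite L1distC.
  by rewrite -!EFinD lee_fin; lra.
have ui n : (lebesgue N).-integrable Omega (EFin \o u (s n)).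
  by apply/Lp1_integrable; have [] := ureg (s n).
(* The extraction provided the rate [1 / 2 ^+ k], hence the constant 1. *)
have [v vi uv] := L1_fast_cauchy_cvg mO ler01 ui sd.
exists s, v; split=> //; first exact/Lp1_integrable.
apply: (@squeeze_cvge _ _ _ _ (cst 0%E) _ (fun k => (2 * 1 / 2 ^+ k)%:E)).
- apply: nearW => k; rewrite LpNorm1B; apply/andP; split; last exact: uv.
  exact: L1dist_ge0.
- exact: cvg_cst.
- apply: cvg_EFin; first exact: nearW.
  apply/cvgrPdist_le => e e0; have [m mP] := geometric_small (2 * 1) e0.
  exists m => // k /= mk; rewrite sub0r normrN ger0_norm; first exact: mP.
  by rewrite divr_ge0 ?exprn_ge0.
Qed.
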